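(* Let $N\ge1$, and let $\lambda,\mu$ be signatures with $N$ parts. Let $\mathbf y=(y_1,y_2,\ldots)$, $\mathbf s=(s_1,s_2,\ldots)$, $\mathbf r=(r_1,\ldots,r_N)$ be complex parameters. Then $$\frac1{N!(2\pi\mathbf i)^N}\oint_\gamma dz_1\cdots\oint_\gamma dz_N\,\frac{\prod_{1\le i\ne j\le N}(z_i-z_j)}{\prod_{i,j=1}^N(r_i^{-2}z_i-z_j)}\,F_\lambda(\mathbf z;\mathbf y;\mathbf r;\mathbf s)\,F^*_\mu(\mathbf z;\mathbf y;\mathbf r;\mathbf s)=\mathbf 1_{\lambda=\mu},$$ where the integration is over $\mathbf z=(z_1,\ldots,z_N)\in\gamma^N$, and $\gamma$ is a simple closed counterclockwise contour containing all the points $y_j$ and not encircling any of the points $y_js_j^{-2}$, $j\ge1$ (the parameters are assumed to be such that $\gamma$ exists). The integrand has no poles at $z_j=r_i^{-2}z_i$ for any $i,j$.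
   Context: A signature with $N$ parts is an integer sequence $\lambda=(\lambda_1\ge\ldots\ge\lambda_N\ge0)$; $\mathcal S(\lambda)=\{\lambda_j+N+1-j:1\le j\le N\}\subset\mathbb Z_{\ge1}$. The function $F_\lambda$. For $i_1,j_1,i_2,j_2\in\{0,1\}$ (numbers of paths entering from the bottom, entering from the left, exiting at the top, exiting to the right) put $\widehat W(\cdot)=\widehat W(\cdot\mid x;y;r;s)$ with $\widehat W(0,0;0,0)=\frac{s^{-2}y-x}{y-x}$, $\widehat W(1,1;1,1)=\frac{r^{-2}x-y}{y-x}$, $\widehat W(1,0;1,0)=\frac{s^{-2}y-r^{-2}x}{y-x}$, $\widehat W(0,1;0,1)=1$, $\widehat W(1,0;0,1)=\frac{x(r^{-2}-1)}{y-x}$, $\widehat W(0,1;1,0)=\frac{y(s^{-2}-1)}{y-x}$, and $\widehat W=0$ otherwise. A configuration on $\mathbb Z_{\ge1}\times\{1,\ldots,N\}$ consists of vertical edge states $v(i,j)\in\{0,1\}$ ($i\ge1$, $0\le j\le N$; $v(i,j-1)$ below and $v(i,j)$ above the vertex $(i,j)$) and horizontal edge states $h(i,j)\in\{0,1\}$ ($i\ge0$, $1\le j\le N$; $h(i-1,j)$ to the left and $h(i,j)$ to the right of $(i,j)$). For $\lambda$ with $N$ parts, $F_\lambda(x_1,\ldots,x_N;\mathbf y;\mathbf r;\mathbf s)$ is the sum over configurations with $v(i,0)=\mathbf 1_{i\in\mathcal S(\lambda)}$, $v(i,N)=0$, $h(0,j)=0$, $h(i,j)=1$ for all large $i$, of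 $\prod_{i\ge1}\prod_{j=1}^N\widehat W(v(i,j-1),h(i-1,j);v(i,j),h(i,j)\mid x_j;y_i;r_j;s_i)$ (finitely many nonzero terms, each with all but finitely many factors equal to $1$). It is a rational function of its arguments. The function $F^*_\lambda$. With $\psi_k(x\mid\mathbf y;\mathbf s)=\frac{y_{k+1}(s_{k+1}^2-1)}{y_{k+1}-s_{k+1}^2x}\prod_{j=1}^k\frac{s_j^2(y_j-x)}{y_j-s_j^2x}$, $k\ge0$, put $$F^*_\lambda(\mathbf x;\mathbf y;\mathbf r;\mathbf s)=\det\left[\psi_{\lambda_j+N-j}(x_i\mid\mathbf y;\mathbf s)\right]_{i,j=1}^N\prod_{N\ge i>j\ge1}\frac{x_j-r_i^{-2}x_i}{x_j-x_i}.$$ The integrand is regarded as a rational function (after cancellation of common factors). *)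

(* Defs.v *)
From HB Require Import structures.
From mathcomp Require Import all_boot all_order all_algebra.
From mathcomp Require Import all_classical all_reals all_analysis.
From mathcomp Require Import complex.
(* The notations of mpoly clash with those of the analysis library. *)
From mathcomp Require Import -(notations) mpoly.

Set Implicit Arguments.
Unset Strict Implicit.
Unset Printing Implicit Defensive.

Import Order.TTheory GRing.Theory Num.Theory.
Import numFieldNormedType.Exports.

Local Open Scope classical_set_scope.
Local Open Scope ring_scope.

(* All indices start at 0: the part lambda_j is [tnth lam (j-1)], and y_j, s_j,
   x_j, r_j are [y (j-1)], [s (j-1)], ...  Likewise column i and row j of the
   lattice are numbered i-1 and j-1. *)

Definition signature (N : nat) (lam : N.-tuple nat) : Prop :=
  forall i j : 'I_N, (i <= j)%N -> (tnth lam j <= tnth lam i)%N.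

(* The elements of S(lambda) are columns numbered from 1; see [boundary]. *)
Definition in_S (N : nat) (lam : N.-tuple nat) (k : nat) : bool :=
  [exists j : 'I_N, k == (tnth lam j + (N - j))%N].

Section Functions.
Variable K : fieldType.
Implicit Types x y r s : K.

(* Arguments: numbers of paths entering from the bottom, entering from the
   left, exiting at the top, exiting to the right. *)
Definition What (i1 j1 i2 j2 : bool) x y r s : K :=
  match i1, j1, i2, j2 with
  | false, false, false, false => (s ^- 2 * y - x) / (y - x)
  | true , true , true , true  => (r ^- 2 * x - y) / (y - x)
  | true , false, true , false => (s ^- 2 * y - r ^- 2 * x) / (y - x)
  | false, true , false, true  => 1
  | true , false, false, true  => x * (r ^- 2 - 1) / (y - x)
  | false, true , true , false => y * (s ^- 2 - 1) / (y - x)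
  | _, _, _, _ => 0
  end.

(* Product of a sequence which has a zero term or has all but finitely many
   terms equal to 1.  The first case has to be singled out because the library's
   product over an infinite support is 1. *)
Definition infprod (f : nat -> K) : K :=
  if `[< exists i, f i = 0 >] then 0 else \big[*%R/1]_(i \in [set: nat]) f i.

(* c.1 i j, with 0 <= j <= N, is the state of the vertical edge of column i
   between the rows j-1 and j; c.2 i j is the state of the horizontal edge of row
   j between the columns i-1 and i. *)
Definition config (N : nat) : Type :=
  ((nat -> 'I_N.+1 -> bool) * (nat -> 'I_N -> bool))%type.

Definition config_weight (N : nat) (x : 'I_N -> K) (y : nat -> K)
    (r : 'I_N -> K) (s : nat -> K) (c : config N) : K :=
  infprod (fun i => \prod_(j < N)
    What (c.1 i (widen_ord (leqnSn N) j)) (c.2 i j)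
         (c.1 i (lift ord0 j)) (c.2 i.+1 j) (x j) (y i) (r j) (s i)).

Definition boundary (N : nat) (lam : N.-tuple nat) (c : config N) : Prop :=
  [/\ forall i, c.1 i ord0 = in_S lam i.+1,
      forall i, c.1 i ord_max = false,
      forall j, c.2 0%N j = false
    & exists M : nat, forall i j, (M <= i)%N -> c.2 i j = true].

Definition Ffun (N : nat) (lam : N.-tuple nat) (x : 'I_N -> K) (y : nat -> K)
    (r : 'I_N -> K) (s : nat -> K) : K :=
  \sum_(c \in [set c : config N | boundary lam c]) config_weight x y r s c.

Definition psi (k : nat) (x : K) (y s : nat -> K) : K :=
  y k * (s k ^+ 2 - 1) / (y k - s k ^+ 2 * x) *
  \prod_(j < k) (s j ^+ 2 * (y j - x) / (y j - s j ^+ 2 * x)).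

Definition Fstar (N : nat) (lam : N.-tuple nat) (x : 'I_N -> K) (y : nat -> K)
    (r : 'I_N -> K) (s : nat -> K) : K :=
  \det (\matrix_(i < N, j < N) psi (tnth lam j + (N - j.+1)) (x i) y s) *
  \prod_(i < N) \prod_(j < N | (j < i)%N)
    ((x j - r i ^- 2 * x i) / (x j - x i)).

Definition integrand_expr (N : nat) (lam mu : N.-tuple nat) (z : 'I_N -> K)
    (y : nat -> K) (r : 'I_N -> K) (s : nat -> K) : K :=
  (\prod_(i < N) \prod_(j < N | j != i) (z i - z j)) /
  (\prod_(i < N) \prod_(j < N) (r i ^- 2 * z i - z j)) *
  Ffun lam z y r s * Fstar mu z y r s.

End Functions.

Section RationalFunctions.
Variables (F : fieldType) (n : nat).

Definition ratfun : fieldType := {fraction (mpoly n F)}.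

Definition ratC (c : F) : ratfun := tofrac (mpolyC n c).
Definition ratX (i : 'I_n) : ratfun := tofrac (mpolyX F (mnm1 i)).

(* f = p / q with q(v) <> 0.  Polynomials form a factorial ring, so such p and q
   exist exactly when the denominator of f in lowest terms is nonzero at v, and
   the value p(v) / q(v) does not depend on p and q. *)
Definition represents (f : ratfun) (v : 'I_n -> F) (p q : mpoly n F) :=
  f = tofrac p / tofrac q /\ meval v q != 0.

Definition regular_at (f : ratfun) (v : 'I_n -> F) : Prop :=
  exists p q, represents f v p q.

(* By convention 0 at the points where f is not regular. *)
Definition ratval (f : ratfun) (v : 'I_n -> F) : F :=
  xget 0 [set c | exists p q, represents f v p q /\
                              c = meval v p / meval v q].

End RationalFunctions.

(* The integrand as a rational function of the 2N variables z_1, ..., z_N,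
   r_1, ..., r_N.  Taking r_1, ..., r_N as indeterminates too gives a meaning to
   the integrand when r_i^2 = 1: the factor r_i^(-2) z_i - z_i of the denominator,
   which then vanishes identically, cancels with F_lambda. *)
Definition integrand (F : fieldType) (N : nat) (lam mu : N.-tuple nat)
    (y s : nat -> F) : ratfun F (N + N) :=
  integrand_expr lam mu (fun i => ratX F (lshift N i)) (fun k => ratC _ (y k))
    (fun i => ratX F (rshift N i)) (fun k => ratC _ (s k)).

Definition zr_point (F : fieldType) (N : nat) (z r : 'I_N -> F)
    (k : 'I_(N + N)) : F :=
  match fintype.split k with inl i => z i | inr i => r i end.

Section Contours.
Variable R : realType.
Implicit Types (g gam : R -> R[i]).

Definition cderive g (t : R) : R[i] :=
  Complex (derive1 (fun u => complex.Re (g u)) t)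
          (derive1 (fun u => complex.Im (g u)) t).

Definition is_C1 g : Prop := forall t : R,
  [/\ derivable (fun u => complex.Re (g u)) t 1,
      derivable (fun u => complex.Im (g u)) t 1,
      {for t, continuous (derive1 (fun u => complex.Re (g u)))}
    & {for t, continuous (derive1 (fun u => complex.Im (g u)))}].

Definition piecewise_C1 gam : Prop :=
  exists (m : nat) (t : nat -> R),
    [/\ t 0%N = 0, t m = 1, forall k, (k < m)%N -> t k < t k.+1
      & forall k, (k < m)%N ->
          exists2 g, is_C1 g & forall u, t k <= u <= t k.+1 -> gam u = g u].

(* Contours are parametrized by [0, 1]; the values of gam elsewhere are
   irrelevant. *)
Definition simple_closed_contour gam : Prop :=
  [/\ piecewise_C1 gam, gam 0 = gam 1
    & forall u v, 0 <= u < 1 -> 0 <= v < 1 -> gam u = gam v -> u = v].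

(* R[i]^o is R[i] with the topology of its norm. *)
Definition contour_image gam : set R[i]^o := [set gam u | u in `[0, 1]].

Definition inside gam (p : R[i]) : Prop :=
  ~ contour_image gam p /\
  bounded_set (connected_component (~` contour_image gam) (p : R[i]^o)).

Definition outside gam (p : R[i]) : Prop :=
  ~ contour_image gam p /\
  ~ bounded_set (connected_component (~` contour_image gam) (p : R[i]^o)).

Definition contour_integral gam (f : R[i] -> R[i]) : R[i] :=
  let h (t : R) : R[i] := f (gam t) * cderive gam t in
  Complex (\int[lebesgue_measure]_(t in `[0, 1]) complex.Re (h t))
          (\int[lebesgue_measure]_(t in `[0, 1]) complex.Im (h t)).

Definition twoipi : R[i] := Complex 0 (2 * pi).

(* The winding number around every point of the interior is 1. *)
Definition counterclockwise gam : Prop :=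
  forall p, inside gam p ->
    contour_integral gam (fun z => (z - p)^-1) = twoipi.

(* The integral dz_1 is the outermost one. *)
Fixpoint iterated_contour_integral gam (N : nat) :
    (N.-tuple R[i] -> R[i]) -> R[i] :=
  match N with
  | 0 => fun f => f [tuple]
  | N'.+1 => fun f => contour_integral gam (fun z =>
      iterated_contour_integral gam (fun w : N'.-tuple R[i] =>
        f [tuple of z :: w]))
  end.

End Contours.

(* Main.v *)
(** The row-to-row operators of the free-fermionic weights map determinants to
    determinants: by Laplace expansion and column operations, adding a row with
    parameters (x, r) to det [phi_(a_j) (x_i)] yields the determinant with the
    additional variable x, up to an explicit factor.  Hence F_lambda is proportional
    to det [phi_(lambda_j + N - j) (x_i)], with
      phi_k (x) = (y_(k+1) - x)^-1 prod_(j <= k) (s_j^-2 y_j - x) / (y_j - x),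
    and all prefactors cancel in the integrand, which equals
    det [phi_(lambda_j + N - j) (z_i)] det [psi_(mu_j + N - j) (z_i)] and does not
    depend on r.  Expanding the determinants reduces the claim to the
    biorthogonality of (phi_k) and (psi_l) on the contour.  For k <> l the product
    phi_k psi_l is a combination of products of at least two factors 1/(z - p) whose
    poles p all have the same winding number, so that its integral vanishes by
    partial fractions; for k = l it is 1/(z - y_(k+1)) - 1/(z - y_(k+1) s_(k+1)^-2). *)

Require Import Defs.
From HB Require Import structures.
From mathcomp Require Import all_boot all_order perm all_algebra.
From mathcomp Require Import all_classical all_reals all_analysis.
From mathcomp Require Import complex.
From mathcomp Require Import -(notations) mpoly.
From mathcomp Require Import measurable_realfun ring lra zify.

Set Implicit Arguments.
Unset Strict Implicit.
Unset Printing Implicit Defensive.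

Import Order.TTheory GRing.Theory Num.Theory.
Import numFieldNormedType.Exports.
Local Open Scope ring_scope.

(** * Rank-one updates of determinants and Slater functions *)

(** Columns are removed one at a time from the left, so the determinants are handled as Slater sums
    defined by recursion on the word of occupied columns, each step being the Laplace expansion
    along the leftmost column. Two statements, for an empty and for an occupied horizontal edge,
    then have to be proved together. The cancellation of prefactors requires distinct z_i and r_i^-2
    z_i different from z_j. This fails on part of gamma^N, and identically when r_i^2 = 1. The
    determinant formula is therefore proved over an arbitrary field, applied to indeterminates z_i
    and r_i, and only then evaluated; as the product of determinants has no such denominators, the
    absence of poles comes with it. No form of the Cauchy theorem enters the analysis. Powers of
    1/(z - p) of exponent at least 2 are integrated by an explicit primitive. The integral of 1/(z -
    p) is known inside by the orientation hypothesis, and it vanishes outside because it is locally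
    constant in p and tends to 0 at infinity. *)

Section RankOne.
Variable K : comNzRingType.

Lemma det_expand_col0 n (u : 'cV[K]_n.+1) (F : 'M[K]_(n.+1, n)) :
  \det (row_mx u F : 'M[K]_(n.+1, 1 + n)) =
  \sum_(k < n.+1) (-1) ^+ k * u k 0 * \det (row' k F).
Proof.
rewrite (expand_det_col _ (0 : 'I_(1 + n))); apply: eq_bigr => k _.
have -> : (0 : 'I_(1 + n)) = lshift n 0 by apply: val_inj.
rewrite /cofactor addn0 mulrA [_ * (-1) ^+ _]mulrC row_mxEl.
congr (_ * \det _); apply/matrixP => i j; rewrite !mxE.
have -> : lift (lshift n 0) j = rshift 1 j by apply: val_inj.
by rewrite (unsplitK (inr j)).
Qed.

Lemma det_add_rows n (g : 'rV[K]_n.+1) (F : 'M[K]_(n, n.+1)) (u : 'cV_n) :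
  \det (col_mx g (F + u *m g) : 'M[K]_(1 + n, n.+1)) =
  \det (col_mx g F : 'M[K]_(1 + n, n.+1)).
Proof.
have -> : (col_mx g (F + u *m g) : 'M[K]_n.+1) =
    (block_mx 1%:M 0 u 1%:M : 'M[K]_(1 + n)) *m (col_mx g F : 'M[K]_(1 + n, n.+1)).
  by rewrite mul_block_col mul1mx mul0mx addr0 mul1mx addrC.
by rewrite det_mulmx det_lblock !det1 !mul1r.
Qed.

(** The alternating sum is the determinant of [F] bordered by the column [u], and [F + u *m g]
    arises from [F] by column operations with that column. *)
Lemma det_add_bordered n (g : 'rV[K]_n) (F : 'M[K]_(n.+1, n)) (u : 'cV_n.+1) :
  \sum_(k < n.+1) (-1) ^+ k * u k 0 * \det (row' k (F + u *m g)) =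
  \sum_(k < n.+1) (-1) ^+ k * u k 0 * \det (row' k F).
Proof.
rewrite -!det_expand_col0.
have -> : (row_mx u (F + u *m g) : 'M[K]_n.+1) =
    (row_mx u F : 'M[K]_(n.+1, 1 + n)) *m (block_mx 1%:M g 0 1%:M : 'M[K]_(1 + n)).
  by rewrite mul_row_block !mulmx1 mulmx0 addr0 addrC.
by rewrite det_mulmx (@det_ublock _ 1) !det1 !mulr1.
Qed.

(** Both sides compute the determinant of the bordered matrix with top row (1, -g) and left column
    (1, u): clearing the top row gives the left side, expansion along the left column the right
    side. *)
Lemma det_rank1 n (A : 'M[K]_n.+1) (u : 'cV_n.+1) (g : 'rV_n.+1) :
  \det (A + u *m g) = \det A +
    \sum_(k < n.+1) (-1) ^+ k * u k 0 * \det (col_mx g (row' k A) : 'M[K]_(1 + n, n.+1)).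
Proof.
have -> : \det (A + u *m g) = \det (block_mx 1%:M (- g) u A : 'M[K]_(1 + n.+1)).
  have: (block_mx 1%:M (- g) u A : 'M[K]_(1 + n.+1)) *m
     (block_mx 1%:M g 0 1%:M : 'M[K]_(1 + n.+1)) = block_mx 1%:M 0 u (A + u *m g).
    rewrite mulmx_block !mulmx1 !mulmx0 !addr0 mul1mx.
    by rewrite subrr [_ + A]addrC.
  move/(congr1 (fun M => \det M)).
  by rewrite det_mulmx (@det_ublock _ 1) !det1 !mulr1 (@det_lblock _ 1) det1 mul1r => ->.
rewrite block_mxEh (@det_expand_col0 n.+1) big_ord_recl; congr (_ + _).
  rewrite expr0 mul1r.
  have -> : (col_mx 1%:M u : 'M[K]_(1 + n.+1, 1)) ord0 0 = 1.
    have -> : ord0 = lshift n.+1 ord0 :> 'I_(1 + n.+1) by apply: val_inj.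
    by rewrite col_mxEu mxE.
  rewrite mul1r; congr (\det _); apply/matrixP => i j; rewrite !mxE.
  have -> : lift ord0 i = rshift 1 i by apply: val_inj.
  by rewrite (unsplitK (inr i)).
apply: eq_bigr => k _.
have -> : (col_mx 1%:M u : 'M[K]_(1 + n.+1, 1)) (lift ord0 k) 0 = u k 0.
  by rewrite -rshift1 col_mxEd.
(* The top row of the minor is still - g; its sign cancels the extra sign of the cofactor, whose row
   index is shifted by one. *)
have -> : row' (lift ord0 k) (col_mx (- g) A : 'M[K]_(1 + n.+1, n.+1)) =
   (block_mx (- 1%:M) 0 0 1%:M : 'M[K]_(1 + n)) *m (col_mx g (row' k A) : 'M[K]_(1 + n, n.+1)).
  rewrite mul_block_col !mul0mx addr0 add0r mul1mx mulNmx mul1mx.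
  apply/matrixP => i j; rewrite [LHS]mxE; case: (unliftP ord0 i) => [i'|] ->.
    have -> : lift (lift ord0 k) (lift ord0 i') = rshift 1 (lift k i').
      by apply: val_inj; rewrite /= /bump /= !add1n ltnS addnS.
    have -> : lift ord0 i' = rshift 1 i' :> 'I_(1 + n) by apply: val_inj.
    by rewrite [LHS]col_mxEd [RHS]col_mxEd mxE.
  have -> : lift (lift ord0 k) ord0 = lshift n.+1 (ord0 : 'I_1) by apply: val_inj.
  have -> : ord0 = lshift n ord0 :> 'I_(1 + n) by apply: val_inj.
  by rewrite [LHS]col_mxEu [RHS]col_mxEu.
rewrite det_mulmx (@det_ublock _ 1) det1 det_mx11 !mxE.
rewrite [nat_of_ord (lift _ _)]lift0 exprS eqxx.
rewrite (_ : 1 *- true = -1 :> K) //; ring.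
Qed.

End RankOne.

Section Slater.
Variable K : comNzRingType.

Fixpoint positions (S : seq bool) : seq nat :=
  if S is b :: S' then
    let p := [seq i.+1 | i <- positions S'] in if b then 0%N :: p else p
  else [::].

Lemma size_positions S : size (positions S) = count id S.
Proof. by elim: S => //= -[] S /= <-; rewrite size_map. Qed.

(** The minor of the array [F] on the occupied columns of [S], in a form that recurses on [S] in
    step with the vertex weights of a row. It is 0 unless [S] has exactly n occupied columns. *)
Fixpoint slater (S : seq bool) (n : nat) : ('I_n -> nat -> K) -> K :=
  match S with
  | [::] => fun _ => (n == 0%N)%:R
  | false :: S' => fun F => slater S' (fun i a => F i a.+1)
  | true :: S' =>
      match n return ('I_n -> nat -> K) -> K with
      | 0%N => fun _ => 0
      | n'.+1 => fun F => \sum_(k < n'.+1) (-1) ^+ k * F k 0%N *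
                            slater S' (fun (i : 'I_n') a => F (lift k i) a.+1)
      end
  end.

Definition slater_mx (S : seq bool) n (F : 'I_n -> nat -> K) : 'M[K]_n :=
  \matrix_(i, j) F i (nth 0%N (positions S) j).

Lemma eq_slater S n (F G : 'I_n -> nat -> K) :
  (forall i a, F i a = G i a) -> slater S F = slater S G.
Proof.
elim: S n F G => [|[] S IH] [|n] F G eqFG //=; first last.
- by apply: IH => i a; rewrite eqFG.
- by apply: IH => i a; rewrite eqFG.
by apply: eq_bigr => k _; rewrite eqFG; congr (_ * _); apply: IH => i a; rewrite eqFG.
Qed.

Lemma slaterE S n (F : 'I_n -> nat -> K) : count id S = n ->
  slater S F = \det (slater_mx S F).
Proof.
elim: S n F => [|[] S IH] n F /=; first by case: n F => [|n] F // _; rewrite det_mx00.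
  case: n F => [|n] F //; rewrite add1n => -[szS].
  rewrite (expand_det_col _ ord0); apply: eq_bigr => k _.
  rewrite !mxE /cofactor addn0 mulrCA mulrA /= IH //; congr (_ * \det _).
  apply/matrixP => i j; rewrite !mxE /= (nth_map 0%N) //.
  by rewrite size_positions szS add0n.
rewrite add0n => szS; rewrite IH //; congr (\det _); apply/matrixP => i j.
by rewrite !mxE (nth_map 0%N) // size_positions szS.
Qed.

Definition consf n (g : nat -> K) (F : 'I_n -> nat -> K) (i : 'I_n.+1) :=
  if unlift ord0 i is Some j then F j else g.

Lemma consf0 n g (F : 'I_n -> nat -> K) : consf g F ord0 = g.
Proof. by rewrite /consf unlift_none. Qed.

Lemma consfS n g (F : 'I_n -> nat -> K) i : consf g F (lift ord0 i) = F i.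
Proof. by rewrite /consf liftK. Qed.

Definition addf n (F : 'I_n -> nat -> K) (u : 'I_n -> K) (g : nat -> K) i a :=
  F i a + u i * g a.

Section Moves.
Variables (S : seq bool) (n : nat) (F : 'I_n -> nat -> K) (g : nat -> K).

Let gv m : 'rV[K]_m := \row_j g (nth 0%N (positions S) j).

Lemma slater_mx_cons m (G : 'I_m -> nat -> K) :
  slater_mx S (consf g G) =
  (col_mx (gv m.+1) (\matrix_(i, j) G i (nth 0%N (positions S) j)) : 'M[K]_(1 + m, m.+1)).
Proof.
apply/matrixP => i j; rewrite [LHS]mxE; case: (unliftP ord0 i) => [k|] ->.
  have -> : lift ord0 k = rshift 1 k :> 'I_(1 + m) by apply: val_inj.
  rewrite [RHS]col_mxEd mxE.
  have -> : rshift 1 k = lift ord0 k :> 'I_m.+1 by apply: val_inj.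
  by rewrite consfS.
rewrite consf0.
have -> : ord0 = lshift m ord0 :> 'I_(1 + m) by apply: val_inj.
by rewrite [RHS]col_mxEu mxE.
Qed.

Lemma slater_add_rows (u : 'I_n -> K) : count id S = n.+1 ->
  slater S (consf g (addf F u g)) = slater S (consf g F).
Proof.
move=> szS; rewrite !slaterE // !slater_mx_cons.
etransitivity; last exact: (det_add_rows _ _ (\col_i u i)).
apply: (congr1 (fun M => \det (col_mx _ M : 'M[K]_(1 + n)))).
by apply/matrixP => i j; rewrite !mxE big_ord1 !mxE.
Qed.

(** The scalar [c] stands for a vertex weight and [u] for the values in column 0: [transfer] adds to
    each row such a multiple of [emit]. *)
Lemma slater_add_bordered m (G : 'I_m.+1 -> nat -> K) (u : 'I_m.+1 -> K) (c : K) :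
  count id S = m ->
  \sum_(k < m.+1) (-1) ^+ k * u k *
    slater S (fun (i : 'I_m) a => addf G (fun j => c * u j) g (lift k i) a) =
  \sum_(k < m.+1) (-1) ^+ k * u k * slater S (fun (i : 'I_m) a => G (lift k i) a).
Proof.
move=> szS.
pose GM := \matrix_(i < m.+1, j < m) G i (nth 0%N (positions S) j).
have := @det_add_bordered K m (c *: gv m) GM (\col_i u i).
congr (_ = _); apply: eq_bigr => k _; rewrite mxE slaterE //; congr (_ * \det _);
  apply/matrixP => i j; rewrite !mxE //.
by rewrite big_ord1 !mxE /addf mulrCA mulrA.
Qed.

Lemma slater_rank1 m (G : 'I_m.+1 -> nat -> K) (u : 'I_m.+1 -> K) :
  count id S = m.+1 ->
  slater S (addf G u g) = slater S G +
    \sum_(k < m.+1) (-1) ^+ k * u k * slater S (consf g (fun (i : 'I_m) a => G (lift k i) a)).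
Proof.
move=> szS; have := @det_rank1 K m (slater_mx S G) (\col_i u i) (gv m.+1).
congr (_ = _ + _).
- rewrite slaterE //; congr (\det _); apply/matrixP => i j.
  by rewrite !mxE big_ord1 !mxE.
- by rewrite slaterE.
apply: eq_bigr => k _; rewrite mxE slaterE // slater_mx_cons.
congr (_ * _); apply: (congr1 (fun M => \det (col_mx _ M : 'M[K]_(1 + m)))).
by apply/matrixP => i j; rewrite !mxE.
Qed.

End Moves.
End Slater.

(** * Row transfer for free-fermionic weights *)

Lemma big_tuple_cons (V : nmodType) (T : finType) n (P : n.+1.-tuple T -> V) :
  \sum_t P t = \sum_b \sum_(t : n.-tuple T) P [tuple of b :: t].
Proof.
rewrite pair_big /=.
rewrite (reindex (fun p : T * n.-tuple T => [tuple of p.1 :: p.2])) //=.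
exists (fun t => (thead t, [tuple of behead t])) => [[b t]|t] _ /=.
  by congr pair; apply: val_inj.
by rewrite -tuple_eta.
Qed.

Section Row.
Variable K : comNzRingType.
Implicit Types (W : nat -> bool -> bool -> bool -> bool -> K) (S T : seq bool).

Lemma slater_scale S n (c : 'I_n -> K) (F : 'I_n -> nat -> K) : count id S = n ->
  slater S (fun i a => c i * F i a) = (\prod_i c i) * slater S F.
Proof.
move=> szS; rewrite !slaterE //.
have -> : \prod_i c i = \det (diag_mx (\row_i c i)).
  by rewrite det_diag; apply: eq_bigr => i _; rewrite mxE.
rewrite -det_mulmx; congr (\det _).
by apply/matrixP => i j; rewrite mul_diag_mx !mxE.
Qed.

Lemma slater_scale0 S n (c : K) g (F : 'I_n -> nat -> K) : count id S = n.+1 ->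
  slater S (consf (fun a => c * g a) F) = c * slater S (consf g F).
Proof.
move=> szS; have := @slater_scale S n.+1 (fun i => if i == ord0 then c else 1) (consf g F) szS.
rewrite big_ord_recl /= big1 // mulr1 => <-; apply: eq_slater => i a.
case: (unliftP ord0 i) => [k|] ->; first by rewrite !consfS /= mul1r.
by rewrite !consf0 eqxx.
Qed.

Definition tailf (A : Type) (f : nat -> A) (k : nat) := f k.+1.

(** Conservation modulo 2 determines each horizontal edge from the other three edges at a vertex,
    and the final [h%:R] makes a path leave the row on the right. *)
Fixpoint row_weight W (h : bool) S T : K :=
  match S, T with
  | b :: S', b' :: T' =>
      let h' := b (+) h (+) b' in W 0%N b h b' h' * row_weight (tailf W) h' S' T'
  | _, _ => h%:R
  end.

(* A path entering from below at column [a] of a row with no other path leaves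
   to the right with weight [emit W a]. *)
Fixpoint emit W (a : nat) : K :=
  if a is a'.+1 then W 0%N false false false false * emit (tailf W) a'
  else W 0%N true false false true.

(* The effect of a row whose leftmost horizontal edge is occupied on the wave
   function [f] of a single path. *)
Fixpoint transfer W (f : nat -> K) (a : nat) : K :=
  if a is a'.+1 then
    transfer (tailf W) (tailf f) a' +
    W 0%N false true true false * f 0%N * emit (tailf W) a'
  else W 0%N true true true true * f 0%N.

(** The vanishing weights are those of the two vertices that respect parity without conserving
    paths. The last equation is the six-vertex relation a1 a2 + b1 b2 = c1 c2, with the weight of a
    horizontal passage normalised to 1. *)
Definition free_fermion W := forall k,
  [/\ W k false true false true = 1, W k false false true true = 0,
      W k true true false false = 0
    & W k false false false false * W k true true true true +
      W k true false true false =
      W k true false false true * W k false true true false].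

Lemma sum_slater_true S n W h (F : 'I_n.+1 -> nat -> K) :
  \sum_(t : (size S).-tuple bool) row_weight W h S t * slater (true :: t) F =
  \sum_(k < n.+1) (-1) ^+ k * F k 0%N *
     \sum_(t : (size S).-tuple bool)
       row_weight W h S t * slater t (fun i a => F (lift k i) a.+1).
Proof.
transitivity (\sum_(t : (size S).-tuple bool) \sum_(k < n.+1) (-1) ^+ k * F k 0%N *
       (row_weight W h S t * slater t (fun i a => F (lift k i) a.+1))).
  by apply: eq_bigr => t _; rewrite mulr_sumr; apply: eq_bigr => k _; rewrite mulrCA.
by rewrite exchange_big; apply: eq_bigr => k _; rewrite mulr_sumr.
Qed.

Lemma slater_true S n (F : 'I_n.+1 -> nat -> K) :
  slater (true :: S) F = \sum_(k < n.+1) (-1) ^+ k * F k 0%N *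
                            slater S (fun (i : 'I_n) a => F (lift k i) a.+1).
Proof. by []. Qed.

Lemma sum_slater_true0 S W h (F : 'I_0 -> nat -> K) :
  \sum_(t : (size S).-tuple bool) row_weight W h S t * slater (true :: t) F = 0.
Proof. by apply: big1 => t _; rewrite mulr0. Qed.

(** The outgoing states enter through equations, so that literal booleans can be supplied for each
    incoming pair. *)
Lemma sum_row_weight_cons W h b S n (F : 'I_n -> nat -> K) h1 h0 :
  h1 = ~~ (b (+) h) -> h0 = b (+) h ->
  \sum_(t : (size (b :: S)).-tuple bool) row_weight W h (b :: S) t * slater t F =
  W 0%N b h true h1 *
    (\sum_(t : (size S).-tuple bool) row_weight (tailf W) h1 S t * slater (true :: t) F) +
  W 0%N b h false h0 *
    (\sum_(t : (size S).-tuple bool) row_weight (tailf W) h0 S t *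
       slater t (fun i => tailf (F i))).
Proof.
move=> -> ->; rewrite big_tuple_cons big_bool.
congr (_ + _); rewrite mulr_sumr; apply: eq_bigr => t _ /=.
  by rewrite addbT mulrA.
by rewrite addbF mulrA.
Qed.

(** Past an empty column 0, [emit] only gains the weight of an empty vertex, while each [transfer]
    gains a multiple of [emit], which row operations with the first row remove. *)
Lemma slater_cons_shift W S n (G : 'I_n -> nat -> K) : count id S = n.+1 ->
  slater S (fun i a => consf (emit W) (fun i => transfer W (G i)) i a.+1) =
  W 0%N false false false false *
    slater S (consf (emit (tailf W)) (fun i => transfer (tailf W) (tailf (G i)))).
Proof.
move=> szS.
rewrite -(slater_add_rows _ _ (fun i => W 0%N false true true false * G i 0%N) szS).
rewrite -slater_scale0 //; apply: eq_slater => i a.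
by case: (unliftP ord0 i) => [k|] ->; rewrite ?consf0 ?consfS.
Qed.

(* Removing column 0 replaces every [transfer W (F i)] by a multiple of itself plus
   a multiple of [emit W]; the determinant is unaffected up to the rank-one terms
   above, and these match the remaining vertex weights exactly when
   A E + D = C B, which is the free-fermion condition. *)
Lemma row_transfer S n W (F : 'I_n -> nat -> K) : free_fermion W ->
  (count id S = n.+1 ->
   \sum_(t : (size S).-tuple bool) row_weight W false S t * slater t F =
   slater S (consf (emit W) (fun i => transfer W (F i)))) /\
  (count id S = n ->
   \sum_(t : (size S).-tuple bool) row_weight W true S t * slater t F =
   slater S (fun i => transfer W (F i))).
Proof.
elim: S n W F => [|b S IH] n W F ffW.
  split=> //= _; rewrite (big_pred1 [tuple]) ?tuple0 /= ?mul1r // => t.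
  by apply/esym/eqP/val_inj; case: t => [[]].
have ffW' : free_fermion (tailf W) by move=> k; apply: ffW.
have [w1 w2 w3 ff] := ffW 0%N.
have IH0 m (G : 'I_m -> _) := (IH m (tailf W) G ffW').1.
have IH1 m (G : 'I_m -> _) := (IH m (tailf W) G ffW').2.
clear IH; case: b; split; rewrite [count _ _]/= ?add1n ?add0n.
- case=> szS; rewrite (@sum_row_weight_cons _ _ _ _ _ _ false true) // IH1 //.
  rewrite [RHS]slater_true [RHS]big_ord_recl expr0 mul1r consf0 [emit _ _]/=.
  rewrite [X in _ = _ * X + _](_ : _ = slater S
    (addf (fun i => transfer (tailf W) (tailf (F i)))
      (fun i => W 0%N false true true false * F i 0%N) (emit (tailf W)))); last first.
    by apply: eq_slater => i a; rewrite consfS.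
  case: n F szS => [|n] F szS.
    rewrite sum_slater_true0 mulr0 big_ord0 add0r addr0; congr (_ * _).
    by apply: eq_slater => -[].
  (* The rank-one expansion isolates the term in which the path of column 0 turns right; the
     remaining sums over k are compared term by term. *)
  rewrite sum_slater_true slater_rank1 // mulrDr addrC -addrA; congr (_ + _).
  rewrite !mulr_sumr -big_split; apply: eq_bigr => k _ /=.
  rewrite IH0 // consfS [transfer _ _ _]/= /bump add1n.
  rewrite [X in _ = _ + _ * X](_ : _ =
      W 0%N false false false false * slater S (consf (emit (tailf W))
      (fun i => transfer (tailf W) (tailf (F (lift k i)))))); last first.
    rewrite -slater_cons_shift //; apply: eq_slater => i a.
    case: (unliftP ord0 i) => [j|] ->.
      have -> : lift (lift ord0 k) (lift ord0 j) = lift ord0 (lift k j).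
        by apply: val_inj; rewrite /= /bump /= !add1n ltnS addnS.
      by rewrite !consfS.
    have -> : lift (lift ord0 k) ord0 = ord0 by apply: val_inj.
    by rewrite !consf0.
  (* The free-fermion relation, solved for the weight of a vertical passage, equates the
     coefficients of the two sums. *)
  have -> : W 0%N true false true false =
    W 0%N true false false true * W 0%N false true true false -
    W 0%N false false false false * W 0%N true true true true by rewrite -ff addrC addKr.
  by rewrite exprS; ring.
- move=> szS; rewrite (@sum_row_weight_cons _ _ _ _ _ _ true false) // w3 mul0r addr0.
  case: n F szS => [|n] F // [szS].
  rewrite sum_slater_true mulr_sumr [RHS]slater_true.
  (* In the expanded determinant the first column is proportional to [F i 0], so the multiples of
     [emit] added by [transfer] are column operations with it. *)
  have := slater_add_bordered (emit (tailf W)) (fun i => transfer (tailf W) (tailf (F i)))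
    (fun i => F i 0%N) (W 0%N false true true false) szS.
  move/(congr1 (fun a => W 0%N true true true true * a)); rewrite !mulr_sumr => E.
  transitivity (\sum_(i < n.+1) W 0%N true true true true * ((-1) ^+ i * F i 0%N *
    slater S (fun (i0 : 'I_n) => transfer (tailf W) (tailf (F (lift i i0)))))).
    by apply: eq_bigr => k _; rewrite IH1.
  rewrite -E; apply: eq_bigr => k _; rewrite !mulrA; congr (_ * _).
  by rewrite mulrAC mulrC !mulrA.
- move=> szS; rewrite (@sum_row_weight_cons _ _ _ _ _ _ true false) // w2 mul0r add0r.
  by rewrite IH0 // -slater_cons_shift.
- move=> szS; rewrite (@sum_row_weight_cons _ _ _ _ _ _ false true) // w1 mul1r IH1 //.
  rewrite [RHS]/=; case: n F szS => [|n] F szS.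
    by rewrite sum_slater_true0 mulr0 add0r; apply: eq_slater => -[].
  rewrite sum_slater_true slater_rank1 // addrC mulr_sumr; congr (_ + _).
  by apply: eq_bigr => k _; rewrite IH0 //; ring.
Qed.
End Row.

(** * Partition function of the lattice *)

Section Partition.
Variable K : fieldType.
Implicit Types (S T : seq bool) (y s : nat -> K).

Definition rowW x r y s k i1 j1 i2 j2 := What i1 j1 i2 j2 x (y k) r (s k).

(* The functions phi_k for which F_lambda is proportional to
   det [phi_(lambda_j + N - j) (x_i)]. *)
Definition phi k x y s : K :=
  (y k - x)^-1 * \prod_(j < k) ((s j ^- 2 * y j - x) / (y j - x)).

Lemma phiS k x y s :
  phi k.+1 x y s = (s 0%N ^- 2 * y 0%N - x) / (y 0%N - x) * phi k x (tailf y) (tailf s).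
Proof. by rewrite /phi big_ord_recl mulrCA. Qed.

Lemma phi0 x y s : phi 0 x y s = (y 0%N - x)^-1.
Proof. by rewrite /phi big_ord0 mulr1. Qed.

Lemma rowW_free_fermion x r y s : (forall k, y k != x) -> free_fermion (rowW x r y s).
Proof.
move=> xy k; split=> //=; rewrite /rowW /=.
move: (r ^- 2) (s k ^- 2) => p q; field.
by rewrite subr_eq0 xy.
Qed.

(** The row of the determinant created by a new path is phi at the variable of the lattice row: this
    is why adding a lattice row adds a variable. *)
Lemma emit_phi x r y s a : emit (rowW x r y s) a = x * (r ^- 2 - 1) * phi a x y s.
Proof.
elim: a y s => [|a IH] y s; first by rewrite phi0.
by rewrite phiS mulrCA -IH.
Qed.

Lemma transfer_scale (W : nat -> bool -> bool -> bool -> bool -> K) c f g a :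
  (forall b, f b = c * g b) -> transfer W f a = c * transfer W g a.
Proof.
elim: a W f g => [|a IH] W f g fg; first by rewrite /= fg mulrCA.
have -> h : transfer W h a.+1 = transfer (tailf W) (tailf h) a +
  W 0%N false true true false * h 0%N * emit (tailf W) a by [].
rewrite (IH _ (tailf f) (tailf g)); last by move=> b; apply: fg.
by rewrite fg mulrDr; congr (_ + _); rewrite !mulrA [c * _]mulrC.
Qed.

(* Up to a multiple of [emit], which a determinant with first row [emit] does not
   see, [phi _ x'] is an eigenfunction of [transfer]. *)
Lemma transfer_phi x r y s x' a : (forall k, y k != x) -> (forall k, y k != x') ->
  x != x' ->
  transfer (rowW x r y s) (fun a => phi a x' y s) a =
  (r ^- 2 * x - x') / (x' - x) * phi a x' y s +
  (x - x')^-1 * emit (rowW x r y s) a.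
Proof.
move=> xy x'y xx'; have x'x : x' != x by rewrite eq_sym.
elim: a y s xy x'y => [|a IH] y s xy x'y.
  rewrite emit_phi /= !phi0 /rowW /=; move: (r ^- 2) => p; field.
  by rewrite !subr_eq0 ?xx' ?x'x ?xy ?x'y.
have IHa := IH (tailf y) (tailf s) (fun k => xy k.+1) (fun k => x'y k.+1).
have -> : transfer (rowW x r y s) (fun a => phi a x' y s) a.+1 =
    (s 0%N ^- 2 * y 0%N - x') / (y 0%N - x') *
    transfer (rowW x r (tailf y) (tailf s)) (fun a => phi a x' (tailf y) (tailf s)) a +
    y 0%N * (s 0%N ^- 2 - 1) / (y 0%N - x) * (y 0%N - x')^-1 *
    emit (rowW x r (tailf y) (tailf s)) a.
  rewrite -(@transfer_scale _ _ (tailf (fun a => phi a x' y s))); last first.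
    by move=> b; rewrite /tailf phiS.
  by rewrite -[(y 0%N - x')^-1](phi0 x' y s).
have -> : emit (rowW x r y s) a.+1 = (s 0%N ^- 2 * y 0%N - x) / (y 0%N - x) *
    emit (rowW x r (tailf y) (tailf s)) a by [].
rewrite {}IHa phiS; move: (phi a _ _ _) (emit _ _) (r ^- 2) (s 0%N ^- 2) => u v p q.
field.
by rewrite !subr_eq0 ?xx' ?x'x ?xy ?x'y.
Qed.

(** A row entered with h = 0 loses exactly one path to the right, so only intermediate states with
    one particle fewer contribute, and to these the induction over rows applies. *)
Lemma row_weight_conserve (W : nat -> bool -> bool -> bool -> bool -> K) h S T :
  free_fermion W -> size S = size T -> row_weight W h S T != 0 ->
  (h + count id S = (count id T).+1)%N.
Proof.
elim: S T W h => [|b S IH] [|b' T] W h ffW //= szS.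
  by case: h => //; rewrite eqxx.
have [_ w2 w3 _] := ffW 0%N.
case: szS => szS; rewrite mulf_eq0 negb_or => /andP[w0].
have ffW' : free_fermion (tailf W) by move=> k; apply: ffW.
move/(IH _ _ _ ffW' szS).
by case: b h b' w0 => [] [] []; rewrite /= ?w2 ?w3 ?eqxx //= ?add0n ?add1n ?addn0 // => _ ->.
Qed.

(* [S] is the state of the bottom edges of the first [L] columns; the rows are
   summed over from bottom to top. *)
Fixpoint partition_sum (y s : nat -> K) (L N : nat) : ('I_N -> K) -> ('I_N -> K) -> seq bool -> K :=
  if N is N'.+1 then fun x r S =>
    \sum_(t : L.-tuple bool) row_weight (rowW (x ord0) (r ord0) y s) false S t *
      partition_sum y s L (fun i : 'I_N' => x (lift ord0 i)) (fun i => r (lift ord0 i)) t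
  else fun _ _ S => (count id S == 0%N)%:R.

(** The factor x_i (r_i^-2 - 1) is the amplitude with which row i emits its path; (r_i^-2 x_i - x_j)
    / (x_j - x_i) is the eigenvalue of row i on phi at the variable x_j of a row above it. *)
Lemma partition_sumE y s L N (x r : 'I_N -> K) S : size S = L -> count id S = N ->
  (forall i k, y k != x i) -> (forall i j : 'I_N, i != j -> x i != x j) ->
  partition_sum y s L x r S =
  (\prod_i (x i * (r i ^- 2 - 1))) *
  (\prod_(i < N) \prod_(j < N | (i < j)%N) ((r i ^- 2 * x i - x j) / (x j - x i))) *
  slater S (fun i a => phi a (x i) y s).
Proof.
elim: N x r S => [|N IH] x r S sizeS szS xy xx.
  rewrite /= !big_ord0 !mul1r slaterE // det_mx00 szS //.
rewrite /= [X in _ = X * _ * _]big_ord_recl [X in _ = _ * X * _]big_ord_recl.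
set cx := \prod_(i < N) _; set cr := \prod_(i < N) _.
set W := rowW _ _ _ _; pose xl (i : 'I_N) := x (lift ord0 i); pose rl (i : 'I_N) := r (lift ord0 i).
pose cr' := \prod_(i < N) \prod_(j < N | (i < j)%N) ((rl i ^- 2 * xl i - xl j) / (xl j - xl i)).
have -> : cr = cr'.
  apply: eq_bigr => i _; rewrite big_mkcond big_ord_recl /= mul1r [RHS]big_mkcond.
  by apply: eq_bigr.
have ffW : free_fermion W by apply: rowW_free_fermion => k; apply: xy.
transitivity (cx * cr' * \sum_(t : L.-tuple bool) row_weight W false S t *
  slater t (fun i a => phi a (xl i) y s)).
  rewrite mulr_sumr; apply: eq_bigr => t _.
  have [->|nz] := eqVneq (row_weight W false S t) 0; first by rewrite !mul0r mulr0.
  have := row_weight_conserve ffW _ nz; rewrite size_tuple add0n szS => /(_ sizeS) [] szt.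
  rewrite (IH _ _ _ (size_tuple t) (esym szt)) //; first by rewrite mulrCA.
  by move=> i j ij; apply: xx; rewrite (inj_eq lift_inj).
subst L; rewrite ((row_transfer S _ ffW).1 szS).
rewrite [X in _ = _ * (X * _) * _]big_mkcond big_ord_recl /= mul1r.
set al := \prod_(i < N) _; have -> :
  slater S (consf (emit W) (fun i => transfer W ((fun i a => phi a (xl i) y s) i))) =
  x ord0 * (r ord0 ^- 2 - 1) * al * slater S (fun i a => phi a (x i) y s).
  (* [F] is the eigenvalue part of the transferred functions and [u] the coefficients of [emit],
     which row operations remove. *)
  pose F i a := (r ord0 ^- 2 * x ord0 - xl i) / (xl i - x ord0) * phi a (xl i) y s.
  pose u i := (x ord0 - xl i)^-1.
  rewrite (_ : slater _ _ = slater S (consf (emit W) (addf F u (emit W)))); last first.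
    apply: eq_slater => i a; case: (unliftP ord0 i) => [k|] ->; rewrite ?consf0 // !consfS.
    by apply: transfer_phi => [k'|k'|]; rewrite ?xy // xx.
  rewrite slater_add_rows //.
  pose c i := if unlift ord0 i is Some k then
     (r ord0 ^- 2 * x ord0 - xl k) / (xl k - x ord0) else x ord0 * (r ord0 ^- 2 - 1).
  have -> : x ord0 * (r ord0 ^- 2 - 1) * al = \prod_i c i.
    rewrite big_ord_recl {1}/c unlift_none; congr (_ * _); apply: eq_bigr => i _.
    by rewrite /c liftK.
  rewrite -slater_scale //; apply: eq_slater => i a.
  case: (unliftP ord0 i) => [k|] ->; rewrite /c ?consfS ?liftK //.
  by rewrite consf0 unlift_none emit_phi.
by ring.
Qed.
End Partition.

(** Needed because occupied columns are listed increasingly and parts decreasingly. Expanding along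
    the last and the first column respectively compares cofactors whose signs differ by (-1)^n, and
    'C(n.+1, 2) = 'C(n, 2) + n. *)
Lemma det_rev_col (K : comNzRingType) n (A : 'M[K]_n) :
  \det (\matrix_(i, j) A i (rev_ord j)) = (-1) ^+ 'C(n, 2) * \det A.
Proof.
elim: n A => [|n IH] A; first by rewrite !det_mx00 mulr1.
rewrite (expand_det_col _ ord_max) (expand_det_col A ord0) mulr_sumr.
apply: eq_bigr => i _; rewrite mxE.
have -> : rev_ord ord_max = ord0 :> 'I_n.+1 by apply: val_inj; rewrite /= subnn.
rewrite [RHS]mulrCA; congr (_ * _); rewrite /cofactor addn0.
have -> : row' i (col' ord_max (\matrix_(i, j) A i (rev_ord j))) =
  \matrix_(k < n, j < n) (row' i (col' ord0 A) : 'M[K]_n) k (rev_ord j).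
  apply/matrixP => k j; rewrite !mxE; congr (A _ _); apply: val_inj => /=.
  rewrite /bump leq0n leqNgt ltn_ord /= add0n add1n subSS subnSK //; exact: ltn_ord j.
rewrite [X in _ * X](IH (row' i (col' ord0 A) : 'M[K]_n)) binS bin1 !exprD.
by rewrite /=; ring.
Qed.

Lemma positionsE (S : seq bool) :
  positions S = [seq i <- iota 0 (size S) | nth false S i].
Proof.
elim: S => //= b S IH; rewrite -[1%N]addn0 iotaDl filter_map IH.
rewrite (eq_filter (a2 := nth false S)) //.
Qed.

(** * Occupation words of signatures *)

Section Signature.
Variables (N : nat) (lam : N.-tuple nat).
Hypothesis hlam : signature lam.

(** The element of S(lambda) given by part j, lowered by one to number columns from 0; it is also
    the index of the functions phi and psi in the determinants. *)
Definition part_pos (j : 'I_N) : nat := tnth lam j + (N - j.+1).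

Lemma part_pos_lt (i j : 'I_N) : (i < j)%N -> (part_pos j < part_pos i)%N.
Proof.
move=> ij; have := hlam (ltnW ij); rewrite /part_pos.
by have := ltn_ord j; lia.
Qed.

Lemma in_SE k : in_S lam k.+1 = (k \in [seq part_pos j | j : 'I_N]).
Proof.
apply/existsP/mapP => [[j /eqP kE]|[j _ ->]]; exists j; rewrite ?mem_enum //; last first.
  by rewrite /part_pos; have := ltn_ord j; lia.
by rewrite /part_pos; have := ltn_ord j; lia.
Qed.

Definition sig_bits L : seq bool := mkseq (fun i => in_S lam i.+1) L.

Lemma sorted_part_pos : sorted ltn (rev [seq part_pos j | j : 'I_N]).
Proof.
rewrite rev_sorted /= sorted_map.
have := iota_ltn_sorted 0 N; rewrite -val_enum_ord sorted_map.
by apply: sub_sorted => i j; apply: part_pos_lt.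
Qed.

Lemma positions_sig_bits L : (forall j, part_pos j < L)%N ->
  positions (sig_bits L) = rev [seq part_pos j | j : 'I_N].
Proof.
move=> posL; rewrite positionsE size_mkseq.
apply: (irr_sorted_eq ltn_trans ltnn) => [||k].
- by apply: sorted_filter; [apply: ltn_trans|apply: iota_ltn_sorted].
- exact: sorted_part_pos.
rewrite mem_filter mem_iota add0n /= mem_rev.
have [kL|Lk] := ltnP k L; first by rewrite andbT nth_mkseq // in_SE.
by rewrite andbF; apply/esym/negbTE/mapP => -[j _ kE];
  move: Lk (posL j); rewrite kE leqNgt => /negP.
Qed.

Lemma count_sig_bits L : (forall j, part_pos j < L)%N -> count id (sig_bits L) = N.
Proof.
by move=> posL; rewrite -size_positions positions_sig_bits // size_rev size_map size_enum_ord.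
Qed.

Lemma slater_sig_bits (K : comNzRingType) L (F : 'I_N -> nat -> K) :
  (forall j, part_pos j < L)%N ->
  slater (sig_bits L) F = (-1) ^+ 'C(N, 2) * \det (\matrix_(i, j) F i (part_pos j)).
Proof.
move=> posL; rewrite slaterE ?count_sig_bits // -det_rev_col; congr (\det _).
have sz : size [seq part_pos j | j : 'I_N] = N by rewrite size_image card_ord.
apply/matrixP => i j; rewrite !mxE positions_sig_bits // nth_rev ?sz //.
rewrite (nth_map j) ?size_enum_ord; last by rewrite ltn_subrL (leq_ltn_trans _ (ltn_ord j)).
congr (F i (part_pos _)); apply: val_inj; rewrite /= nth_enum_ord //.
by rewrite ltn_subrL (leq_ltn_trans _ (ltn_ord j)).
Qed.

End Signature.

(** * From configurations to row-by-row sums *)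

(* The horizontal edges of a row are determined by the vertical edges [a] below and
   [b] above it, by conservation of paths modulo 2. *)
Fixpoint hstate (a b : nat -> bool) (h : bool) (i : nat) : bool :=
  if i is i'.+1 then a i' (+) hstate a b h i' (+) b i' else h.

Lemma hstate_shift a b h i :
  hstate a b h i.+1 = hstate (tailf a) (tailf b) (a 0%N (+) h (+) b 0%N) i.
Proof. by elim: i => //= i <-. Qed.

Section Config.
Variable K : fieldType.
Implicit Types (y s : nat -> K).

Lemma row_weightE (W : nat -> bool -> bool -> bool -> bool -> K) h S T : size S = size T ->
  let hs := hstate (nth false S) (nth false T) h in
  row_weight W h S T = (hs (size S))%:R *
    \prod_(i < size S) W i (nth false S i) (hs i) (nth false T i) (hs i.+1).
Proof.
elim: S T W h => [|b S IH] [|b' T] W h //; first by rewrite /= big_ord0 mulr1.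
case=> szS hs; rewrite [row_weight _ _ _ _]/= IH // [size (b :: S)]/= big_ord_recl mulrCA /hs.
rewrite hstate_shift; congr (_ * (_ * _)); apply: eq_bigr => i _.
by rewrite !hstate_shift.
Qed.

Lemma big_ffun_cons (T : finType) n (P : {ffun 'I_n.+1 -> T} -> K) :
  \sum_V P V = \sum_t \sum_(V : {ffun 'I_n -> T})
    P [ffun i => oapp V t (unlift ord0 i)].
Proof.
rewrite pair_big /=.
rewrite (reindex (fun p : T * {ffun 'I_n -> T} =>
  [ffun i => oapp p.2 p.1 (unlift ord0 i)])) //=.
exists (fun V : {ffun 'I_n.+1 -> T} => (V ord0, [ffun i => V (lift ord0 i)])) => [[t V]|V] _ /=.
  congr pair; first by rewrite ffunE unlift_none.
  by apply/ffunP => i; rewrite !ffunE liftK.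
apply/ffunP => i; rewrite ffunE.
by case: (unliftP ord0 i) => [j|] ->; rewrite ?liftK ?unlift_none //= ffunE.
Qed.

Lemma partition_sum_ffun y s L N (x r : 'I_N -> K) (S : L.-tuple bool) :
  partition_sum y s L x r S =
  \sum_(V : {ffun 'I_N.+1 -> L.-tuple bool} |
         (V ord0 == S) && (count id (V ord_max) == 0%N))
    \prod_(j < N) row_weight (rowW (x j) (r j) y s) false
      (V (widen_ord (leqnSn N) j)) (V (lift ord0 j)).
Proof.
elim: N x r S => [|N IH] x r S.
  rewrite big_mkcond (bigD1 [ffun=> S]) //= !ffunE eqxx big_ord0 big1 ?addr0; first by case: eqP.
  move=> V VS; rewrite ifN //; apply: contra VS => /andP[/eqP V0 _].
  by apply/eqP/ffunP => i; rewrite ffunE ord1 V0.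
rewrite [RHS]big_mkcond /= big_ffun_cons [RHS](bigD1 S) //= [X in _ = _ + X]big1 ?addr0; last first.
  by move=> t tS; apply: big1 => V _; rewrite ffunE unlift_none /= (negbTE tS).
rewrite -big_mkcond (partition_big (fun V : {ffun 'I_N.+1 -> L.-tuple bool} => V ord0) xpredT) //=.
apply: eq_bigr => t _; rewrite IH mulr_sumr; apply: eq_big => V.
  rewrite !ffunE unlift_none /= eqxx /=.
  have -> : ord_max = lift ord0 (@ord_max N) by apply: val_inj.
  by rewrite liftK andbC.
move=> /andP[/eqP <- _]; rewrite big_ord_recl !ffunE.
have -> : widen_ord (leqnSn N.+1) ord0 = ord0 by apply: val_inj.
rewrite unlift_none liftK /=; congr (_ * _); apply: eq_bigr => j _.
rewrite !ffunE !liftK.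
have -> : widen_ord (leqnSn N.+1) (lift ord0 j) = lift ord0 (widen_ord (leqnSn N) j).
  by apply: val_inj.
by rewrite liftK.
Qed.

Lemma What_conserve i1 j1 i2 j2 (x y r s : K) : What i1 j1 i2 j2 x y r s != 0 ->
  (i1 + j1 = i2 + j2)%N.
Proof. by case: i1 j1 i2 j2 => [] [] [] [] //=; rewrite eqxx. Qed.

Lemma infprod_finite (f : nat -> K) L : (forall i, (L <= i)%N -> f i = 1) ->
  infprod f = \prod_(i < L) f i.
Proof.
move=> f1; rewrite /infprod; case: asboolP => [[i fi0]|_].
  have iL : (i < L)%N by rewrite ltnNge; apply/negP => /f1 /eqP; rewrite fi0 eq_sym oner_eq0.
  by rewrite (bigD1 (Ordinal iL)) //= fi0 mul0r.
rewrite fsbig_ord; apply/esym/fsbig_widen => // i [_ /=].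
by move/negP; rewrite -leqNgt => /f1.
Qed.

Section Fsum.
Variables (N L : nat) (lam : N.-tuple nat) (x r : 'I_N -> K) (y s : nat -> K).
Hypothesis hlam : signature lam.
Hypothesis posL : forall j, (part_pos lam j < L)%N.
Let cfg := {ffun 'I_N.+1 -> L.-tuple bool}.

(** Only the vertical edges of the first [L] columns are free. The default value of [nth] leaves
    those further right empty, and the horizontal edges are reconstructed from the vertical ones. *)
Definition conf_of (V : cfg) : config N :=
  (fun i j => nth false (V j) i,
   fun i j => hstate (nth false (V (widen_ord (leqnSn N) j)))
                     (nth false (V (lift ord0 j))) false i).

Lemma conf_of_inj : injective conf_of.
Proof.
move=> V V' [e _]; apply/ffunP => j; apply: val_inj; apply: (@eq_from_nth _ false).
  by rewrite !size_tuple.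
by move=> i _; exact: (congr1 (fun f => f i j) e).
Qed.

Lemma hstate_stable (V : cfg) i j : (L <= i)%N -> (conf_of V).2 i j = (conf_of V).2 L j.
Proof.
move=> /subnK <-; elim: (i - L)%N => //= k <-.
by rewrite !nth_default ?size_tuple ?leq_addl // addbF.
Qed.

Lemma config_weight_conf_of (V : cfg) : (forall j, (conf_of V).2 L j) ->
  config_weight x y r s (conf_of V) =
  \prod_(j < N) row_weight (rowW (x j) (r j) y s) false
      (V (widen_ord (leqnSn N) j)) (V (lift ord0 j)).
Proof.
move=> hL; rewrite /config_weight (@infprod_finite _ L).
  rewrite exchange_big /=; apply: eq_bigr => j _.
  have := hL j; rewrite /= => hLj.
  by rewrite row_weightE ?size_tuple //= hLj mul1r.
(* From column [L] on, every vertex is only crossed horizontally and has weight 1. *)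
move=> i Li; apply: big1 => j _; rewrite !(hstate_stable V) ?hL ?(leqW Li) //.
by rewrite /= !nth_default ?size_tuple.
Qed.


Lemma boundary_conf_of (V : cfg) : V ord0 = sig_bits lam L :> seq bool ->
  count id (V ord_max) = 0%N -> (forall j, (conf_of V).2 L j) ->
  boundary lam (conf_of V).
Proof.
move=> V0 Vmax hL; split=> //=.
- move=> i; rewrite V0; have [iL|Li] := ltnP i L; first by rewrite nth_mkseq.
  rewrite nth_default ?size_mkseq // in_SE; apply/esym/negbTE/mapP => -[j _ iE].
  by move: Li (posL j); rewrite iE leqNgt => /negP.
- move=> i; have [iL|Li] := ltnP i L; last by rewrite nth_default ?size_tuple.
  have /hasPn nV : ~~ has id (V ord_max) by rewrite has_count Vmax.
  by apply/negbTE/(nV (nth false (V ord_max) i)); rewrite mem_nth ?size_tuple.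
by exists L => i j Li; have := hL j; rewrite -(hstate_stable _ _ Li).
Qed.

(* The horizontal flux through a column is the number of paths that have entered
   to its left.  It equals N from column L on, so all horizontal edges are
   occupied there and nothing can turn upwards. *)
Lemma boundary_conserve (c : config N) : boundary lam c ->
  (forall i j, (c.1 i (widen_ord (leqnSn N) j) + c.2 i j =
                c.1 i (lift ord0 j) + c.2 i.+1 j)%N) ->
  (forall i j, (L <= i)%N -> c.2 i j) /\ (forall i j, (L <= i)%N -> c.1 i j = false).
Proof.
move=> [c0 cmax h0 _] cons.
(* When conservation is summed over the rows, the interior vertical edges cancel and the top one is
   empty. *)
have flux i : (\sum_(j < N) c.2 i.+1 j = \sum_(j < N) c.2 i j + c.1 i ord0)%N.
  have e : (\sum_(j < N) c.1 i (widen_ord (leqnSn N) j) =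
      c.1 i ord0 + \sum_(j < N) c.1 i (lift ord0 j))%N.
    have := erefl (\sum_(j < N.+1) (c.1 i j : nat))%N.
    by rewrite {1}big_ord_recr /= cmax addn0 big_ord_recl.
  have : (\sum_(j < N) (c.1 i (widen_ord (leqnSn N) j) + c.2 i j) =
         \sum_(j < N) (c.1 i (lift ord0 j) + c.2 i.+1 j))%N by apply: eq_bigr.
  by rewrite !big_split /= e addnAC [in RHS]addnC => /addIn <-; rewrite addnC.
have fluxE i : (\sum_(j < N) c.2 i j = \sum_(k < i) in_S lam k.+1)%N.
  elim: i => [|i IH]; first by rewrite big_ord0 big1 // => j _; rewrite h0.
  by rewrite flux IH big_ord_recr /= c0.
have out k : (L <= k)%N -> in_S lam k.+1 = false.
  move=> Lk; rewrite in_SE; apply/negbTE/mapP => -[j _ kE].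
  by move: Lk (posL j); rewrite kE leqNgt => /negP.
have fluxL i : (L <= i)%N -> (\sum_(j < N) c.2 i j = N)%N.
  move=> /subnK <-; rewrite fluxE; elim: (i - L)%N => [|k IH].
    have := count_sig_bits hlam posL; rewrite /sig_bits -sum1_count big_map.
    have -> : iota 0 L = index_iota 0 L by rewrite /index_iota subn0.
    rewrite add0n big_mkcond big_mkord => {2}<-.
    by apply: eq_bigr => k _; case: in_S.
  by rewrite addSn big_ord_recr /= IH out ?leq_addl // addn0.
have hL i j : (L <= i)%N -> c.2 i j.
  move=> /fluxL; rewrite (bigD1 j) //=; case: (c.2 i j) => // e.
  have : (\sum_(k < N | k != j) c.2 i k <= \sum_(k < N | k != j) 1)%N.
    by apply: leq_sum => k _; case: (c.2 i k).
  rewrite sum1_card cardC1 card_ord -[X in (X <= _)%N]add0n e.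
  by rewrite -ltnS prednK ?ltnn // (leq_ltn_trans _ (ltn_ord j)).
split=> // i j Li; case: j => j jN; elim: j jN => [|j IH] jN.
  by rewrite (_ : Ordinal jN = ord0) ?c0 ?out //; apply: val_inj.
have jN' : (j < N)%N by [].
have := cons i (Ordinal jN'); rewrite !hL ?(leqW Li) //.
have -> : widen_ord (leqnSn N) (Ordinal jN') = Ordinal (ltnW jN) by apply: val_inj.
have -> : lift ord0 (Ordinal jN') = Ordinal jN by apply: val_inj.
by rewrite IH; case: (c.1 i _).
Qed.

(** A nonzero weight forces conservation at every vertex, which empties the vertical edges from
    column [L] on and determines the horizontal ones. The sum defining F_lambda thus has finite
    support. *)
Lemma boundary_weight (c : config N) : boundary lam c -> config_weight x y r s c != 0 ->
  exists V : cfg, [/\ c = conf_of V, V ord0 = sig_bits lam L :> seq bool,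
    count id (V ord_max) = 0%N & forall j, (conf_of V).2 L j].
Proof.
move=> bc nz; have [c0 cmax h0 _] := bc.
have cons i j : (c.1 i (widen_ord (leqnSn N) j) + c.2 i j =
                c.1 i (lift ord0 j) + c.2 i.+1 j)%N.
  apply: (@What_conserve _ _ _ _ (x j) (y i) (r j) (s i)).
  (* A vanishing vertex weight gives a zero factor, and [infprod] is then 0. *)
  apply: contraNneq nz => w0; rewrite /config_weight /infprod; case: asboolP => // -[].
  by exists i; rewrite (bigD1 j) //= w0 mul0r.
have [hL vL] := boundary_conserve bc cons.
pose V : cfg := [ffun j => [tuple c.1 i j | i < L]].
have vE i j : nth false (V j) i = c.1 i j.
  rewrite ffunE; have [iL|Li] := ltnP i L.
    by rewrite (nth_mktuple _ _ (Ordinal iL)).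
  by rewrite nth_default ?size_tuple // vL.
have cV : c = conf_of V.
  case: c {bc nz c0 cmax} h0 cons hL vL V vE => c1 c2 /= h0 cons hL vL V vE; congr pair.
    by apply/funext => i; apply/funext => j; rewrite vE.
  apply/funext => i; apply/funext => j; elim: i => [|i IH] /=; first by rewrite h0.
  rewrite !vE -IH; have := cons i j.
  by case: (c1 _ _) (c1 _ _) (c2 i j) (c2 i.+1 j) => [] [] [] [].
exists V; split=> //; last by move=> j; rewrite -cV hL.
- apply: (@eq_from_nth _ false); first by rewrite size_tuple size_mkseq.
  by move=> i; rewrite size_tuple => iL; rewrite vE c0 nth_mkseq.
apply/eqP; rewrite -leqn0 leqNgt -has_count; apply/(has_nthP false) => -[i _].
by rewrite vE cmax.
Qed.

Lemma Ffun_partition_sum :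
  Ffun lam x y r s = partition_sum y s L x r (sig_bits lam L).
Proof.
have szS : size (sig_bits lam L) == L by rewrite size_mkseq.
rewrite -[sig_bits lam L]/(val (Tuple szS)) partition_sum_ffun.
(* When [Q] fails, some row ends with an empty horizontal edge and the last factor of its
   [row_weight] is 0; when it holds, [conf_of V] has the required behaviour on the right. *)
pose Q (V : cfg) := [forall j, (conf_of V).2 L j].
rewrite (bigID Q) /= [X in _ = _ + X]big1 ?addr0; last first.
  move=> V /andP[_]; rewrite negb_forall => /existsP[j /negbTE hj].
  by move: hj; rewrite /= => hj; rewrite (bigD1 j) //= row_weightE ?size_tuple //= hj !mul0r.
pose cs := [seq conf_of V | V in [pred V : cfg |
  (V ord0 == Tuple szS) && (count id (V ord_max) == 0%N) & Q V]].
transitivity (\sum_(c <- cs) config_weight x y r s c); last first.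
  rewrite big_image; apply: eq_bigr => V /andP[_ /forallP]; exact: config_weight_conf_of.
rewrite fsbig_seq; last by rewrite map_inj_uniq ?enum_uniq //; exact: conf_of_inj.
apply/esym/fsbig_widen => [c /= /mapP[V]|c [bc /= ncs]].
  rewrite mem_enum inE => /andP[/andP[/eqP V0 /eqP Vmax] /forallP hV] ->.
  by apply: boundary_conf_of => //; rewrite V0.
apply: contra_notP ncs => /eqP/(boundary_weight bc)[V [-> V0 Vmax hV]].
apply/mapP; exists V => //; rewrite mem_enum inE Vmax eqxx andbT; apply/andP; split.
  by apply/eqP/val_inj.
exact/forallP.
Qed.

End Fsum.
End Config.

(** * The integrand as a product of determinants *)

Lemma prod_sign_lt (K : comNzRingType) n :
  \prod_(i < n) \prod_(j < n | (i < j)%N) (-1) = (-1) ^+ 'C(n, 2) :> K.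
Proof.
elim: n => [|n IH]; first by rewrite big_ord0.
rewrite big_ord_recl big_mkcond big_ord_recl /= mul1r prodr_const card_ord.
rewrite binS bin1 exprD mulrC -IH; congr (_ * _); apply: eq_bigr => i _.
by rewrite big_mkcond big_ord_recl /= mul1r [RHS]big_mkcond.
Qed.

Section Integrand.
Variable K : fieldType.

Lemma Ffun_det N (lam : N.-tuple nat) (x r : 'I_N -> K) (y s : nat -> K) :
  signature lam -> (forall i k, y k != x i) ->
  (forall i j : 'I_N, i != j -> x i != x j) ->
  Ffun lam x y r s =
  (\prod_i (x i * (r i ^- 2 - 1))) *
  (\prod_(i < N) \prod_(j < N | (i < j)%N) ((r i ^- 2 * x i - x j) / (x j - x i))) *
  ((-1) ^+ 'C(N, 2) * \det (\matrix_(i < N, j < N) phi (part_pos lam j) (x i) y s)).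
Proof.
move=> hlam xy xx.
have posL j : (part_pos lam j < (\max_(i < N) part_pos lam i).+1)%N.
  by rewrite ltnS leq_bigmax.
rewrite (Ffun_partition_sum _ _ _ _ hlam posL) partition_sumE //.
- by rewrite (slater_sig_bits hlam _ posL).
- by rewrite size_mkseq.
- exact: count_sig_bits.
Qed.

Lemma integrand_expr_det N (lam mu : N.-tuple nat) (z r : 'I_N -> K) (y s : nat -> K) :
  signature lam -> (forall i k, y k != z i) ->
  (forall i j : 'I_N, i != j -> z i != z j) ->
  (forall i j : 'I_N, r i ^- 2 * z i != z j) ->
  integrand_expr lam mu z y r s =
  \det (\matrix_(i < N, j < N) phi (part_pos lam j) (z i) y s) *
  \det (\matrix_(i < N, j < N) psi (part_pos mu j) (z i) y s).
Proof.
move=> hlam zy zz rz; rewrite /integrand_expr Ffun_det // /Fstar.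
(* Factors with j < i cancel against those of [Fstar], factors with i < j against the eigenvalues in
   F_lambda, and the diagonal of the denominator against the emission amplitudes. *)
have split2 (F : 'I_N -> 'I_N -> K) : \prod_(i < N) \prod_(j < N | j != i) F i j =
    (\prod_(i < N) \prod_(j < N | (j < i)%N) F i j) *
    (\prod_(i < N) \prod_(j < N | (i < j)%N) F i j).
  rewrite -big_split; apply: eq_bigr => i _ /=.
  rewrite (bigID (fun j : 'I_N => (j < i)%N)) /=; congr (_ * _); apply: eq_bigl => j.
    by rewrite -val_eqE /= neq_ltn; case: ltngtP.
  by rewrite -val_eqE /= neq_ltn; case: ltngtP.
have split3 (F : 'I_N -> 'I_N -> K) : \prod_(i < N) \prod_(j < N) F i j =
    (\prod_(i < N) F i i) * (\prod_(i < N) \prod_(j < N | j != i) F i j).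
  rewrite -big_split; apply: eq_bigr => i _ /=.
  by rewrite (bigD1 i).
rewrite split3 !split2.
pose D i j := z i - z j; pose P i j := r i ^- 2 * z i - z j.
have D0 i j : i != j -> D i j != 0 by move=> ij; rewrite subr_eq0 zz.
have P0 i j : P i j != 0 by rewrite subr_eq0.
have -> : \prod_i (z i * (r i ^- 2 - 1)) = \prod_i P i i.
  by apply: eq_bigr => i _; rewrite /P mulrBr mulr1 mulrC.
(* The sign produced by turning z_j - z_i into z_i - z_j cancels that of the column reversal in
   F_lambda. *)
have -> : \prod_(i < N) \prod_(j < N | (i < j)%N) ((r i ^- 2 * z i - z j) / (z j - z i)) =
  (\prod_(i < N) \prod_(j < N | (i < j)%N) P i j) /
  ((-1) ^+ 'C(N, 2) * \prod_(i < N) \prod_(j < N | (i < j)%N) D i j).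
  rewrite -prod_sign_lt -big_split /= -prodf_div; apply: eq_bigr => i _.
  rewrite -big_split /= -prodf_div; apply: eq_bigr => j _.
  by rewrite mulN1r opprB.
have -> : \prod_(i < N) \prod_(j < N | (j < i)%N) ((z j - r i ^- 2 * z i) / (z j - z i)) =
  (\prod_(i < N) \prod_(j < N | (j < i)%N) P i j) /
  (\prod_(i < N) \prod_(j < N | (j < i)%N) D i j).
  rewrite -prodf_div; apply: eq_bigr => i _; rewrite -prodf_div; apply: eq_bigr => j _.
  by rewrite -[z j - z i]opprB -[_ - r i ^- 2 * _]opprB mulNr invrN mulrN opprK.
have nzD (C : 'I_N -> 'I_N -> bool) : (forall i j, C i j -> i != j) ->
   \prod_(i < N) \prod_(j < N | C i j) D i j != 0.
  by move=> CP; apply/prodf_neq0 => i _; apply/prodf_neq0 => j /CP; exact: D0.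
have nzP (C : 'I_N -> 'I_N -> bool) : \prod_(i < N) \prod_(j < N | C i j) P i j != 0.
  by apply/prodf_neq0 => i _; apply/prodf_neq0 => j _; exact: P0.
have := nzP (fun i j => i < j)%N; have := nzP (fun i j => j < i)%N.
have := nzD (fun i j => i < j)%N; have := nzD (fun i j => j < i)%N.
have : \prod_i P i i != 0 by apply/prodf_neq0.
rewrite -/P -/D.
set a := \prod_(i < N) P i i; set b := \prod_(i < N) _; set c := \prod_(i < N) _.
set d := \prod_(i < N) _; set e := \prod_(i < N) _ => a0 b0 c0 d0 e0.
have sgn0 : (-1) ^+ 'C(N, 2) != 0 :> K by rewrite expf_neq0 // oppr_eq0 oner_eq0.
have {}b0 : b != 0 by apply: b0 => i j; rewrite -val_eqE /= neq_ltn orbC => ->.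
have {}c0 : c != 0 by apply: c0 => i j; rewrite -val_eqE /= neq_ltn => ->.
move: (\det _) (\det _) ((-1) ^+ _) sgn0 => u v w w0.
field.
by rewrite a0 b0 c0 d0 e0 w0.
Qed.
End Integrand.

(** * Values of rational functions *)

Section FractionValue.
Variables (A : idomainType) (K F : fieldType).
Variables (emb : {rmorphism A -> K}) (ev : {rmorphism A -> F}).
Hypothesis emb_inj : injective emb.
Implicit Types (f g : K) (c d : F).

(** A relation rather than a function, so that closure under the field operations involves no choice
    of numerator and denominator. [emb] and [ev] stand for [tofrac] and [meval]. *)
Definition has_value f c :=
  exists p q, [/\ f = emb p / emb q, ev q != 0 & c = ev p / ev q].

Lemma emb_den_neq0 q : ev q != 0 -> emb q != 0.
Proof.
by apply: contraNneq => e; rewrite (emb_inj (etrans e (esym (rmorph0 emb)))) rmorph0.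
Qed.

Lemma has_value_uniq f c d : has_value f c -> has_value f d -> c = d.
Proof.
case=> p [q [-> q0 ->]] [p' [q' [+ q'0 ->]]] => /eqP.
rewrite eqr_div ?emb_den_neq0 // -!rmorphM => /eqP/emb_inj/(congr1 ev).
by rewrite !rmorphM => e; apply/eqP; rewrite eqr_div // e.
Qed.

Lemma has_value_emb p : has_value (emb p) (ev p).
Proof. by exists p, 1; rewrite !rmorph1 oner_eq0 !divr1. Qed.

Lemma has_value0 : has_value 0 0.
Proof. by have := has_value_emb 0; rewrite !rmorph0. Qed.

Lemma has_value1 : has_value 1 1.
Proof. by have := has_value_emb 1; rewrite !rmorph1. Qed.

Lemma has_valueD f g c d : has_value f c -> has_value g d -> has_value (f + g) (c + d).
Proof.
case=> p [q [-> q0 ->]] [p' [q' [-> q'0 ->]]].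
exists (p * q' + p' * q), (q * q').
by rewrite !rmorphD !rmorphM mulf_neq0 // !addf_div ?emb_den_neq0.
Qed.

Lemma has_valueM f g c d : has_value f c -> has_value g d -> has_value (f * g) (c * d).
Proof.
case=> p [q [-> q0 ->]] [p' [q' [-> q'0 ->]]]; exists (p * p'), (q * q').
by rewrite !rmorphM mulf_neq0 // !mulf_div.
Qed.

Lemma has_valueV f c : c != 0 -> has_value f c -> has_value f^-1 c^-1.
Proof.
move=> + [p [q [-> q0 cE]]]; rewrite cE mulf_eq0 invr_eq0 (negbTE q0) orbF => p0.
by exists q, p; rewrite !invf_div.
Qed.

Lemma has_valueN f c : has_value f c -> has_value (- f) (- c).
Proof.
case=> p [q [-> q0 ->]]; exists (- p), q.
by rewrite !rmorphN !mulNr.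
Qed.

Lemma has_valueB f g c d : has_value f c -> has_value g d -> has_value (f - g) (c - d).
Proof. by move=> fc /has_valueN; apply: has_valueD. Qed.

Lemma has_value_exp f c k : has_value f c -> has_value (f ^+ k) (c ^+ k).
Proof.
move=> fc; elim: k => [|k IH]; first exact: has_value1.
by rewrite !exprS; apply: has_valueM.
Qed.

Lemma has_value_prod (I : Type) (s : seq I) (P : pred I) (f : I -> K) (c : I -> F) :
  (forall i, P i -> has_value (f i) (c i)) ->
  has_value (\prod_(i <- s | P i) f i) (\prod_(i <- s | P i) c i).
Proof.
move=> fc; apply: (big_ind2 has_value) => //; first exact: has_value1.
by move=> *; apply: has_valueM.
Qed.

Lemma has_value_det m (M : 'M[K]_m) (B : 'M[F]_m) :
  (forall i j, has_value (M i j) (B i j)) -> has_value (\det M) (\det B).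
Proof.
move=> MB; apply: (big_ind2 has_value); first exact: has_value0.
  by move=> *; apply: has_valueD.
move=> s _; apply: has_valueM; last exact: has_value_prod.
by apply/has_value_exp/has_valueN/has_value1.
Qed.

(** The genericity conditions on indeterminates are verified in this way, by one specialization that
    separates the two sides. *)
Lemma has_value_neq f g c d : has_value f c -> has_value g d -> c != d -> f != g.
Proof.
by move=> fc gd; apply: contraNneq => fg; rewrite fg in fc; rewrite (has_value_uniq fc gd).
Qed.

Variables (y s : nat -> F) (Y S : nat -> K).
Hypotheses (Yy : forall k, has_value (Y k) (y k)) (Ss : forall k, has_value (S k) (s k)).

Lemma has_value_phi k f c : has_value f c -> (forall j, s j != 0) -> (forall j, y j != c) ->
  has_value (phi k f Y S) (phi k c y s).
Proof.
move=> fc s0 yc.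
have den j : has_value (Y j - f)^-1 (y j - c)^-1.
  by apply: has_valueV; [rewrite subr_eq0|apply: has_valueB].
apply: has_valueM => //; apply: has_value_prod => j _; apply: has_valueM => //.
apply: has_valueB => //; apply: has_valueM => //; apply: has_valueV; first exact: expf_neq0.
exact: has_value_exp.
Qed.

Lemma has_value_psi k f c : has_value f c -> (forall j, y j != s j ^+ 2 * c) ->
  has_value (psi k f Y S) (psi k c y s).
Proof.
move=> fc nz.
have den j : has_value (Y j - S j ^+ 2 * f)^-1 (y j - s j ^+ 2 * c)^-1.
  apply: has_valueV; first by rewrite subr_eq0.
  by apply: has_valueB => //; apply: has_valueM => //; apply: has_value_exp.
apply: has_valueM; first apply: has_valueM => //.
  apply: has_valueM => //; apply: has_valueB; last exact: has_value1.
  exact: has_value_exp.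
apply: has_value_prod => j _; apply: has_valueM => //.
apply: has_valueM; first exact: has_value_exp.
exact: has_valueB.
Qed.
End FractionValue.

Section RationalFunction.
Variables (F : fieldType) (n : nat).
Implicit Types (f g : ratfun F n) (v : 'I_n -> F).

Definition rat_has_value f v c :=
  @has_value (mpoly n F) (ratfun F n) F (@tofrac (mpoly n F)) (meval v) f c.

Lemma tofrac_inj : injective (@tofrac (mpoly n F)).
Proof. by move=> p q /eqP; rewrite tofrac_eq => /eqP. Qed.

Lemma rat_has_valueC v c : rat_has_value (ratC n c) v c.
Proof. by rewrite -[in X in rat_has_value _ _ X](mevalC v c); apply: has_value_emb. Qed.

Lemma rat_has_valueX v i : rat_has_value (ratX F i) v (v i).
Proof. by rewrite -(mevalXU v i); apply: has_value_emb. Qed.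

Lemma ratval_has_value f v c : rat_has_value f v c -> ratval f v = c.
Proof.
move=> fc; rewrite /ratval; apply: xget_unique.
  by case: fc => p [q [fE q0 cE]]; exists p, q.
move=> d [p [q [[fE q0] dE]]].
apply: (has_value_uniq tofrac_inj _ fc).
by exists p, q.
Qed.

Lemma rat_has_value_regular f v c : rat_has_value f v c -> regular_at f v.
Proof. by case=> p [q [fE q0 _]]; exists p, q. Qed.
End RationalFunction.

Section IntegrandValue.
Variables (F : numFieldType) (N : nat) (lam mu : N.-tuple nat) (y s : nat -> F).
Hypothesis hlam : signature lam.

Lemma zr_point_l (z r : 'I_N -> F) i : zr_point z r (lshift N i) = z i.
Proof. by rewrite /zr_point (unsplitK (inl i)). Qed.

Lemma zr_point_r (z r : 'I_N -> F) i : zr_point z r (rshift N i) = r i.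
Proof. by rewrite /zr_point (unsplitK (inr i)). Qed.

(* The determinant formula needs the z_i and r_i in general position, which holds
   for indeterminates; the specialization to z and r comes afterwards. *)
Lemma integrand_value (z r : 'I_N -> F) : (forall k, s k != 0) ->
  (forall i k, y k != z i) -> (forall i k, y k != s k ^+ 2 * z i) ->
  rat_has_value (integrand lam mu y s) (zr_point z r)
    (\det (\matrix_(i < N, j < N) phi (part_pos lam j) (z i) y s) *
     \det (\matrix_(i < N, j < N) psi (part_pos mu j) (z i) y s)).
Proof.
move=> s0 yz ysz.
have zv z' r' i : rat_has_value (ratX F (lshift N i)) (zr_point z' r') (z' i).
  by rewrite -(zr_point_l z' r'); apply: rat_has_valueX.
have rv z' r' i : rat_has_value (ratX F (rshift N i)) (zr_point z' r') (r' i).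
  by rewrite -(zr_point_r z' r'); apply: rat_has_valueX.
have two0 : 2 != 0 :> F by rewrite pnatr_eq0.
rewrite /integrand integrand_expr_det //.
- apply: has_valueM; apply: (has_value_det (@tofrac_inj F _)) => i j; rewrite !mxE.
    exact: (has_value_phi (@tofrac_inj F _) (fun k => rat_has_valueC _ (y k))
              (fun k => rat_has_valueC _ (s k)) _ (zv z r i) s0 (yz i)).
  exact: (has_value_psi (@tofrac_inj F _) (fun k => rat_has_valueC _ (y k))
            (fun k => rat_has_valueC _ (s k)) _ (zv z r i) (ysz i)).
- move=> i k.
  apply: (has_value_neq (@tofrac_inj F _) (rat_has_valueC (zr_point (fun=> y k + 1) r) (y k))
    (zv (fun=> y k + 1) r i)).
  by rewrite -subr_eq0 opprD addNKr oppr_eq0 oner_eq0.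
- move=> i j ij.
  apply: (has_value_neq (@tofrac_inj F _) (zv (fun k => (k == i)%:R) r i)
    (zv (fun k => (k == i)%:R) r j)).
  by rewrite eqxx [j == i]eq_sym (negbTE ij) oner_eq0.
move=> i j.
(* At z = 1 and r = 2 the two sides are 1/4 and 1, which differ because 3 is nonzero in [F]. *)
apply: (has_value_neq (@tofrac_inj F _) _ (zv (fun=> 1) (fun=> 2) j)).
  apply: has_valueM; last exact: (zv (fun=> 1) (fun=> 2) i).
  apply: has_valueV; last by apply: has_value_exp; exact: (rv (fun=> 1) (fun=> 2) i).
  by rewrite expf_neq0.
by rewrite mulr1 invr_eq1 -subr_eq0 (_ : 2 ^+ 2 - 1 = 3%:R :> F) ?pnatr_eq0 //; ring.
Qed.
End IntegrandValue.

(** * Contour integrals *)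

Section PiecewiseIntegral.
Local Open Scope classical_set_scope.
Local Open Scope ring_scope.
Variable R : realType.
Local Notation mu := (@lebesgue_measure R).
Implicit Types (f g G : R -> R) (a b c : R) (t : nat -> R).

Lemma integrable_oo_cc f a b : mu.-integrable `]a, b[ (EFin \o f) ->
  mu.-integrable `[a, b] (EFin \o f).
Proof.
move=> /integrableP[mf fi].
have mfc : measurable_fun `[a, b] (EFin \o f).
  by apply/emeasurable_fun_itv_obnd_cbndP/emeasurable_fun_itv_bndo_bndcP.
apply/integrableP; split => //.
rewrite integral_itv_bndoo //; apply: measurableT_comp => //.
Qed.

(** At a break point the derivative of the contour need not be that of either piece, so agreement is
    asked only on the open interval; the end points are null. *)
Lemma piece_integral f g a b : a < b -> {within `[a, b], continuous g} ->
  {in `]a, b[, f =1 g} ->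
  mu.-integrable `[a, b] (EFin \o f) /\
  (\int[mu]_(x in `[a, b]) f x = \int[mu]_(x in `[a, b]) g x)%R.
Proof.
move=> ab cg fg.
have ig : mu.-integrable `[a, b] (EFin \o g).
  by apply: continuous_compact_integrable => //; apply: segment_compact.
have igo : mu.-integrable `]a, b[ (EFin \o g).
  by apply: integrableS ig => //; apply: subset_itv_oo_cc.
have ifo : mu.-integrable `]a, b[ (EFin \o f).
  by apply: eq_integrable igo => // x; rewrite inE /= => xab; rewrite /= fg.
split; first exact: integrable_oo_cc.
rewrite /Rintegral; congr fine; apply: eq_integral_itv_bounded => //.
  by apply/measurable_EFinP; apply: measurable_int ifo.
by apply/measurable_EFinP; apply: measurable_int igo.
Qed.

Lemma itv_cc_setU a b c : a <= b -> b <= c -> `[a, c]%classic = `[a, b] `|` `]b, c] :> set R.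
Proof.
by move=> ab bc; rewrite -itv_bndbnd_setU // bnd_simp.
Qed.

Lemma integrable_cc_setU f a b c : a <= b -> b <= c ->
  mu.-integrable `[a, b] (EFin \o f) -> mu.-integrable `[b, c] (EFin \o f) ->
  mu.-integrable `[a, c] (EFin \o f) /\
  (\int[mu]_(x in `[a, c]) f x =
   \int[mu]_(x in `[a, b]) f x + \int[mu]_(x in `[b, c]) f x)%R.
Proof.
move=> ab bc f1 f2.
have f2' : mu.-integrable `]b, c] (EFin \o f).
  by apply: integrableS f2 => //; apply: subset_itvr; rewrite bnd_simp.
have dis : [disjoint `[a, b]%classic & `]b, c]%classic].
  apply/disj_setPS => x /= []; rewrite !in_itv /= => /andP[_ xb] /andP[bx _].
  by move: bx; rewrite ltNge xb.
have fac : mu.-integrable `[a, c] (EFin \o f).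
  rewrite (itv_cc_setU ab bc).
  move/integrableP : f1 => [m1 i1]; move/integrableP : f2' => [m2 i2].
  have m12 : measurable_fun (`[a, b] `|` `]b, c]) (EFin \o f) by apply/measurable_funU.
  apply/integrableP; split => //; rewrite ge0_integral_setU //.
    by rewrite lte_add_pinfty.
  by apply: measurableT_comp.
split=> //; rewrite (itv_cc_setU ab bc) Rintegral_setU -?itv_cc_setU //.
by rewrite Rintegral_itv_obnd_cbnd.
Qed.

(** Additivity over adjacent intervals requires integrability, so both conclusions share one
    induction; the increments of [G] telescope. *)
Lemma piecewise_integral f (G : R -> R) t m :
  (forall k, (k < m)%N -> t k < t k.+1) ->
  (forall k, (k < m)%N -> mu.-integrable `[t k, t k.+1] (EFin \o f)) ->
  mu.-integrable `[t 0%N, t m] (EFin \o f) /\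
  ((forall k, (k < m)%N ->
     (\int[mu]_(x in `[t k, t k.+1]) f x = G (t k.+1) - G (t k))%R) ->
  (\int[mu]_(x in `[t 0%N, t m]) f x = G (t m) - G (t 0%N))%R).
Proof.
elim: m => [|m IH] tS pf.
  rewrite set_itv1; split; first apply: null_set_integrable => //.
  - exact: measurable_fun_set1.
  - exact: lebesgue_measure_set1.
  by move=> _; rewrite Rintegral_set1 subrr.
have [i0 e0] := IH (fun k km => tS k (ltnW km)) (fun k km => pf k (ltnW km)).
have t0m : t 0%N <= t m.
  clear -tS; elim: m tS => // m IH tS; apply: (le_trans (IH (fun k km => tS k (ltnW km)))).
  by apply/ltW/tS.
have [i1 e1] := integrable_cc_setU t0m (ltW (tS m (leqnn _))) i0 (pf m (leqnn _)).
split=> // Gf; rewrite e1 e0 ?Gf ?leqnn //; last by move=> k km; apply: Gf; rewrite ltnW.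
by rewrite addrC addrA subrK.
Qed.
End PiecewiseIntegral.

(** * Continuity and derivatives through real and imaginary parts *)

Section ComplexParts.
Local Open Scope classical_set_scope.
Local Open Scope ring_scope.
Variable R : realType.
Implicit Types z w : R[i].
Local Notation Re := (@complex.Re R).
Local Notation Im := (@complex.Im R).

Lemma cReD z w : Re (z + w) = Re z + Re w. Proof. by case: z w => [a b] []. Qed.
Lemma cImD z w : Im (z + w) = Im z + Im w. Proof. by case: z w => [a b] []. Qed.
Lemma cReN z : Re (- z) = - Re z. Proof. by case: z. Qed.
Lemma cImN z : Im (- z) = - Im z. Proof. by case: z. Qed.
Lemma cReM z w : Re (z * w) = Re z * Re w - Im z * Im w.
Proof. by case: z w => [a b] []. Qed.
Lemma cImM z w : Im (z * w) = Re z * Im w + Im z * Re w.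
Proof. by case: z w => [a b] [c d] /=. Qed.
Lemma cReV z : Re z^-1 = Re z / (Re z ^+ 2 + Im z ^+ 2).
Proof. by case: z. Qed.
Lemma cImV z : Im z^-1 = - (Im z / (Re z ^+ 2 + Im z ^+ 2)).
Proof. by case: z. Qed.

Lemma ReIm_eq z w : Re z = Re w -> Im z = Im w -> z = w.
Proof. by case: z w => [a b] [c d] /= -> ->. Qed.

Lemma sqr_ReIm_neq0 z : z != 0 -> Re z ^+ 2 + Im z ^+ 2 != 0.
Proof.
apply: contraNneq => /eqP; rewrite paddr_eq0 ?sqr_ge0 // !sqrf_eq0 => /andP[/eqP a /eqP b].
by apply/eqP/ReIm_eq.
Qed.

Definition ccont (h : R -> R[i]) (t : R) :=
  {for t, continuous (fun u => Re (h u))} /\ {for t, continuous (fun u => Im (h u))}.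

Lemma eq_ccont h k t : h =1 k -> ccont h t -> ccont k t.
Proof. by move=> /funext ->. Qed.

Lemma ccont_cst c t : ccont (fun=> c) t.
Proof. by split; apply: cst_continuous. Qed.

Lemma ccontD h k t : ccont h t -> ccont k t -> ccont (fun u => h u + k u) t.
Proof.
move=> [h1 h2] [k1 k2]; split.
  rewrite (_ : (fun u => _) = (fun u => Re (h u)) + (fun u => Re (k u))).
    exact: continuousD.
  by apply/funext => u; rewrite cReD.
rewrite (_ : (fun u => _) = (fun u => Im (h u)) + (fun u => Im (k u))).
  exact: continuousD.
by apply/funext => u; rewrite cImD.
Qed.

Lemma ccontM h k t : ccont h t -> ccont k t -> ccont (fun u => h u * k u) t.
Proof.
move=> [h1 h2] [k1 k2]; split.
  rewrite (_ : (fun u => _) = (fun u => Re (h u)) * (fun u => Re (k u))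
     - (fun u => Im (h u)) * (fun u => Im (k u))).
    by apply: continuousB; apply: continuousM.
  by apply/funext => u; rewrite cReM.
rewrite (_ : (fun u => _) = (fun u => Re (h u)) * (fun u => Im (k u))
   + (fun u => Im (h u)) * (fun u => Re (k u))).
  by apply: continuousD; apply: continuousM.
by apply/funext => u; rewrite cImM.
Qed.

Lemma ccontN h t : ccont h t -> ccont (fun u => - h u) t.
Proof.
by move=> ch; apply: (eq_ccont _ (ccontM (ccont_cst (-1) t) ch)) => u; rewrite mulN1r.
Qed.

Lemma ccontV h t : h t != 0 -> ccont h t -> ccont (fun u => (h u)^-1) t.
Proof.
move=> ht0 [h1 h2].
pose q := (fun u => Re (h u)) * (fun u => Re (h u)) + (fun u => Im (h u)) * (fun u => Im (h u)).
have cq : {for t, continuous (fun u => (q u)^-1)}.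
  apply: continuousV; first by rewrite /q /= -!expr2 sqr_ReIm_neq0.
  by apply: continuousD; apply: continuousM.
split.
  rewrite (_ : (fun u => _) = (fun u => Re (h u)) * (fun u => (q u)^-1)).
    exact: continuousM.
  by apply/funext => u; rewrite cReV !expr2.
rewrite (_ : (fun u => _) = - ((fun u => Im (h u)) * (fun u => (q u)^-1))).
  by apply: continuousN; apply: continuousM.
by apply/funext => u; rewrite cImV !expr2.
Qed.

Definition cder (h : R -> R[i]) (t : R) (d : R[i]) :=
  is_derive t 1 (fun u => Re (h u)) (Re d) /\ is_derive t 1 (fun u => Im (h u)) (Im d).

Lemma cder_eq h k t d e : h =1 k -> d = e -> cder h t d -> cder k t e.
Proof. by move=> /funext -> ->. Qed.

Lemma cder_cst c t : cder (fun=> c) t 0.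
Proof. by split; apply: is_derive_cst. Qed.

Lemma cderD h k t d e : cder h t d -> cder k t e -> cder (fun u => h u + k u) t (d + e).
Proof.
move=> [h1 h2] [k1 k2]; split.
  rewrite (_ : (fun u => _) = (fun u => Re (h u)) + (fun u => Re (k u))).
    by rewrite cReD; apply: is_deriveD.
  by apply/funext => u; rewrite cReD.
rewrite (_ : (fun u => _) = (fun u => Im (h u)) + (fun u => Im (k u))).
  by rewrite cImD; apply: is_deriveD.
by apply/funext => u; rewrite cImD.
Qed.

Lemma cderM h k t d e : cder h t d -> cder k t e ->
  cder (fun u => h u * k u) t (h t * e + k t * d).
Proof.
move=> [h1 h2] [k1 k2]; split.
  rewrite (_ : (fun u => _) = (fun u => Re (h u)) * (fun u => Re (k u))
     - (fun u => Im (h u)) * (fun u => Im (k u))).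
    by apply: is_derive_eq; rewrite cReD !cReM /GRing.scale /=; ring.
  by apply/funext => u; rewrite cReM.
rewrite (_ : (fun u => _) = (fun u => Re (h u)) * (fun u => Im (k u))
   + (fun u => Im (h u)) * (fun u => Re (k u))).
  by apply: is_derive_eq; rewrite cImD !cImM /GRing.scale /=; ring.
by apply/funext => u; rewrite cImM.
Qed.

Lemma is_derive_inv (f : R -> R) t d : f t != 0 -> is_derive t 1 f d ->
  is_derive t 1 (fun u => (f u)^-1) (- (f t) ^- 2 * d).
Proof.
move=> ft0 [df <-]; apply: DeriveDef; first exact: derivableV.
by rewrite deriveV.
Qed.

Lemma cderV h t d : h t != 0 -> cder h t d ->
  cder (fun u => (h u)^-1) t (- (h t) ^- 2 * d).
Proof.
move=> ht0 [h1 h2].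
pose a u := Re (h u); pose b u := Im (h u).
pose q := a * a + b * b.
have qt0 : a t ^+ 2 + b t ^+ 2 != 0 by rewrite sqr_ReIm_neq0.
have dq : is_derive t 1 (fun u => (q u)^-1)
    (- (q t) ^- 2 * (a t *: Re d + a t *: Re d + (b t *: Im d + b t *: Im d))).
  by apply: is_derive_inv; rewrite /q /= -!expr2.
have hE : - h t ^- 2 * d = - ((h t)^-1 * (h t)^-1 * d) by rewrite -exprVn expr2 mulNr.
have qE : q t = a t ^+ 2 + b t ^+ 2 by rewrite /q /= -!expr2.
split.
  rewrite (_ : (fun u => _) = a * (fun u => (q u)^-1)).
    apply: is_derive_eq; rewrite hE cReN !(cReM, cImM, cReV, cImV) qE /=.
    rewrite -/(a t) -/(b t) /GRing.scale /=; field.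
    by rewrite qt0.
  by apply/funext => u; rewrite cReV !expr2.
rewrite (_ : (fun u => _) = - (b * (fun u => (q u)^-1))).
  apply: is_derive_eq; rewrite hE cImN !(cReM, cImM, cReV, cImV) qE /=.
  rewrite -/(a t) -/(b t) /GRing.scale /=; field.
  by rewrite qt0.
by apply/funext => u; rewrite cImV !expr2.
Qed.

End ComplexParts.

(** * Integration along a piecewise C1 contour *)

Section Contour.
Local Open Scope classical_set_scope.
Local Open Scope ring_scope.
Variable R : realType.
Local Notation Re := (@complex.Re R).
Local Notation Im := (@complex.Im R).
Local Notation mu := (@lebesgue_measure R).
Variable gam : R -> R[i].
Hypothesis pw : piecewise_C1 gam.
Implicit Types f F : R[i] -> R[i].

Definition on_contour (z : R[i]) : Prop := exists2 t, 0 <= t <= 1 & gam t = z.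

Lemma contour_imageE z : contour_image gam z <-> on_contour z.
Proof.
split=> [[t /=]|[t t01 <-]]; first by rewrite in_itv /= => t01 <-; exists t.
by exists t; rewrite //= in_itv.
Qed.

(* Continuity is only tested along C1 curves: this is all that integration along
   a piecewise C1 contour requires. *)
Definition contour_continuous f := forall (g : R -> R[i]) t, is_C1 g ->
  on_contour (g t) -> ccont (fun u => f (g u)) t.

Lemma is_C1_cder (g : R -> R[i]) t : is_C1 g -> cder g t (cderive g t).
Proof.
by move=> /(_ t)[d1 d2 _ _]; split; apply: DeriveDef => //=; rewrite derive1E.
Qed.

Lemma cder_ccont (h : R -> R[i]) t d : cder h t d -> ccont h t.
Proof.
by move=> [[d1 _] [d2 _]]; split; apply/differentiable_continuous/derivable1_diffP.
Qed.

Lemma is_C1_ccont_cderive (g : R -> R[i]) t : is_C1 g -> ccont (cderive g) t.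
Proof. by move=> /(_ t)[_ _ c1 c2]. Qed.

Lemma contour_continuous_cst c : contour_continuous (fun=> c).
Proof. by move=> g t _ _; apply: ccont_cst. Qed.

Lemma contour_continuous_id : contour_continuous id.
Proof. by move=> g t gC1 _; apply: cder_ccont (is_C1_cder t gC1). Qed.

Lemma contour_continuousD f F : contour_continuous f -> contour_continuous F ->
  contour_continuous (fun z => f z + F z).
Proof. by move=> cf cF g t gC1 gt; apply: ccontD; [apply: cf|apply: cF]. Qed.

Lemma contour_continuousM f F : contour_continuous f -> contour_continuous F ->
  contour_continuous (fun z => f z * F z).
Proof. by move=> cf cF g t gC1 gt; apply: ccontM; [apply: cf|apply: cF]. Qed.

Lemma contour_continuousN f : contour_continuous f -> contour_continuous (fun z => - f z).
Proof. by move=> cf g t gC1 gt; apply: ccontN; apply: cf. Qed.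

Lemma contour_continuousV f : (forall z, on_contour z -> f z != 0) ->
  contour_continuous f -> contour_continuous (fun z => (f z)^-1).
Proof. by move=> f0 cf g t gC1 gt; apply: ccontV; [apply: f0|apply: cf]. Qed.

Lemma contour_continuous_prod (I : Type) (s : seq I) (P : pred I) (f : I -> R[i] -> R[i]) :
  (forall i, P i -> contour_continuous (f i)) ->
  contour_continuous (fun z => \prod_(i <- s | P i) f i z).
Proof.
move=> cf; elim: s => [|i s IH] g t gC1 gt.
  by apply: (eq_ccont _ (ccont_cst 1 t)) => u; rewrite big_nil.
case Pi: (P i).
  apply: (eq_ccont _ (ccontM (cf i Pi g t gC1 gt) (IH g t gC1 gt))) => u.
  by rewrite big_cons Pi.
by apply: (eq_ccont _ (IH g t gC1 gt)) => u; rewrite big_cons Pi.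
Qed.

Lemma contour_continuousX f n : contour_continuous f ->
  contour_continuous (fun z => f z ^+ n).
Proof.
move=> cf g t gC1 gt; elim: n => [|n IH].
  by apply: (eq_ccont _ (ccont_cst 1 t)) => u; rewrite expr0.
by apply: (eq_ccont _ (ccontM (cf g t gC1 gt) IH)) => u; rewrite exprS.
Qed.

Lemma cderive_piece (g : R -> R[i]) a b t : (forall u, a <= u <= b -> gam u = g u) ->
  a < t < b -> cderive gam t = cderive g t.
Proof.
move=> gE /andP[at_ tb]; rewrite /cderive !derive1E.
have tab : t \in `]a, b[ by rewrite in_itv /= at_.
have near_eq : \forall u \near t, gam u = g u.
  near=> u; apply: gE.
  have : u \in `]a, b[ by near: u; apply: near_in_itvoo.
  by rewrite in_itv /= => /andP[/ltW -> /ltW ->].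
congr Complex; apply: near_eq_derive.
  by apply: filterS near_eq => u ->.
by apply: filterS near_eq => u ->.
Unshelve. all: by end_near. Qed.

Definition cintegrand f t := f (gam t) * cderive gam t.

Lemma ccont_within (h : R -> R[i]) a b : (forall t, a <= t <= b -> ccont h t) ->
  {within `[a, b], continuous (fun u => Re (h u))} /\
  {within `[a, b], continuous (fun u => Im (h u))}.
Proof.
move=> ch; split; apply: continuous_in_subspaceT => t; rewrite inE /= in_itv /= => tab;
  by have [] := ch t tab.
Qed.

Lemma contour_pieces : exists (m : nat) (t : nat -> R),
  [/\ t 0%N = 0, t m = 1, forall k, (k < m)%N -> t k < t k.+1 &
  forall k, (k < m)%N -> exists2 g, is_C1 g &
     (forall u, t k <= u <= t k.+1 -> gam u = g u) /\
     (forall u, t k <= u <= t k.+1 -> on_contour (g u))].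
Proof.
have [m [t [t0 tm tS pieces]]] := pw; exists m, t; split=> // k km.
have [g gC1 gE] := pieces k km; exists g => //.
have t_le i j : (i <= j)%N -> (j <= m)%N -> t i <= t j.
  move=> /subnK <-; elim: (j - i)%N => // d IH dm.
  by apply: le_trans (IH (ltnW dm)) _; apply: ltW; apply: tS.
split=> // u uk.
exists u; last exact: gE.
have /andP[uk1 uk2] := uk.
rewrite -t0 -tm (le_trans (t_le _ _ (leq0n k) (ltnW km)) uk1).
exact: le_trans uk2 (t_le _ _ km (leqnn _)).
Qed.

Lemma piece_FTC2 (g G : R -> R) a b : a < b ->
  (forall u, a <= u <= b -> {for u, continuous g}) ->
  (forall u, a <= u <= b -> is_derive u 1 G (g u)) ->
  (\int[mu]_(x in `[a, b]) g x = G b - G a)%R.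
Proof.
move=> ab cg dG; rewrite /Rintegral (@continuous_FTC2 _ g G) //.
- apply: continuous_in_subspaceT => u; rewrite inE /= in_itv /=; exact: cg.
- have cG u : a <= u <= b -> {for u, continuous G}.
    by move=> /dG [d _]; apply/differentiable_continuous/derivable1_diffP.
  split.
  + by move=> u; rewrite in_itv /= => /andP[au ub]; have [] := dG u; rewrite ?(ltW au) ?(ltW ub).
  + by apply: cvg_at_right_filter; apply: cG; rewrite lexx ltW.
  + by apply: cvg_at_left_filter; apply: cG; rewrite lexx ltW.
- move=> u; rewrite in_itv /= => /andP[au ub]; rewrite derive1E.
  by have [|_ ->] := dG u; rewrite ?(ltW au) ?(ltW ub).
Qed.

Lemma contour_piece f (g : R -> R[i]) a b : a < b -> contour_continuous f -> is_C1 g ->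
  (forall u, a <= u <= b -> gam u = g u) ->
  (forall u, a <= u <= b -> on_contour (g u)) ->
  [/\ forall u, a <= u <= b -> ccont (fun u => f (g u) * cderive g u) u,
      mu.-integrable `[a, b] (EFin \o (fun t => Re (cintegrand f t))),
      mu.-integrable `[a, b] (EFin \o (fun t => Im (cintegrand f t))),
      (\int[mu]_(x in `[a, b]) Re (cintegrand f x) =
       \int[mu]_(x in `[a, b]) Re (f (g x) * cderive g x))%R &
      (\int[mu]_(x in `[a, b]) Im (cintegrand f x) =
       \int[mu]_(x in `[a, b]) Im (f (g x) * cderive g x))%R].
Proof.
move=> ab cf gC1 gE gon.
have cfg u : a <= u <= b -> ccont (fun u => f (g u) * cderive g u) u.
  move=> uk; apply: ccontM; last exact: is_C1_ccont_cderive.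
  by apply: cf => //; apply: gon.
have [c1 c2] := ccont_within cfg.
have eqg u : u \in `]a, b[ -> cintegrand f u = f (g u) * cderive g u.
  rewrite in_itv /= => uk; rewrite /cintegrand (cderive_piece gE uk) gE //.
  by have /andP[/ltW -> /ltW ->] := uk.
have [|i1 e1] := @piece_integral _ (fun t => Re (cintegrand f t)) _ _ _ ab c1.
  by move=> u uk; rewrite /= eqg.
have [|i2 e2] := @piece_integral _ (fun t => Im (cintegrand f t)) _ _ _ ab c2.
  by move=> u uk; rewrite /= eqg.
by split; [exact: cfg|exact: i1|exact: i2|exact: e1|exact: e2].
Qed.

Lemma contour_integrable f : contour_continuous f ->
  mu.-integrable `[0, 1] (EFin \o (fun t => Re (cintegrand f t))) /\
  mu.-integrable `[0, 1] (EFin \o (fun t => Im (cintegrand f t))).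
Proof.
move=> cf; have [m [t [t0 tm tS pieces]]] := contour_pieces.
rewrite -t0 -tm.
split; apply: (piecewise_integral (fun=> 0) tS _).1 => k km;
  have [g gC1 [gE gon]] := pieces k km;
  by have [] := contour_piece (tS k km) cf gC1 gE gon.
Qed.

(** The condition on [F] is the chain rule along C1 curves at points of the contour, in place of
    holomorphy; the increments of [F] over the pieces telescope. *)
Lemma contour_FTC f F : contour_continuous f ->
  (forall g t, is_C1 g -> on_contour (g t) ->
     cder (fun u => F (g u)) t (f (g t) * cderive g t)) ->
  contour_integral gam f = F (gam 1) - F (gam 0).
Proof.
move=> cf dF; have [m [t [t0 tm tS pieces]]] := contour_pieces.
have HRe : (\int[mu]_(x in `[t 0%N, t m]) Re (cintegrand f x) =
    Re (F (gam (t m))) - Re (F (gam (t 0%N))))%R.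
  apply: (@piecewise_integral _ (fun t => Re (cintegrand f t))
           (fun t => Re (F (gam t))) t m tS _).2 => k km;
    have [g gC1 [gE gon]] := pieces k km;
    have [cfg i1 _ e1 _] := contour_piece (tS k km) cf gC1 gE gon.
    exact: i1.
  rewrite e1; rewrite gE; last by rewrite lexx (ltW (tS k km)).
  rewrite gE; last by rewrite lexx (ltW (tS k km)).
  apply: (@piece_FTC2 (fun u => Re (f (g u) * cderive g u)) (fun u => Re (F (g u))) _ _
    (tS k km)) => u uk; first by have [] := cfg u uk.
  by have [] := dF g u gC1 (gon u uk).
have HIm : (\int[mu]_(x in `[t 0%N, t m]) Im (cintegrand f x) =
    Im (F (gam (t m))) - Im (F (gam (t 0%N))))%R.
  apply: (@piecewise_integral _ (fun t => Im (cintegrand f t))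
           (fun t => Im (F (gam t))) t m tS _).2 => k km;
    have [g gC1 [gE gon]] := pieces k km;
    have [cfg _ i1 _ e1] := contour_piece (tS k km) cf gC1 gE gon.
    exact: i1.
  rewrite e1; rewrite gE; last by rewrite lexx (ltW (tS k km)).
  rewrite gE; last by rewrite lexx (ltW (tS k km)).
  apply: (@piece_FTC2 (fun u => Im (f (g u) * cderive g u)) (fun u => Im (F (g u))) _ _
    (tS k km)) => u uk; first by have [] := cfg u uk.
  by have [] := dF g u gC1 (gon u uk).
move: HRe HIm; rewrite t0 tm => HRe HIm.
by apply: ReIm_eq; rewrite ?cReD ?cReN ?cImD ?cImN; [exact: HRe|exact: HIm].
Qed.
End Contour.

(** * Estimates with the real-valued modulus *)

Section NormC.
Local Open Scope classical_set_scope.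
Local Open Scope ring_scope.
Variable R : realType.
Local Notation Re := (@complex.Re R).
Local Notation Im := (@complex.Im R).
Local Notation Nc := (@Normc.normc R).
Implicit Types z w : R[i].

Lemma Nc_ge0 z : 0 <= Nc z.
Proof. by case: z => a b; apply: sqrtr_ge0. Qed.

Lemma Nc_gt0 z : (0 < Nc z) = (z != 0).
Proof.
rewrite lt_neqAle Nc_ge0 andbT eq_sym; congr negb; apply/eqP/eqP => [|->].
  exact: Normc.eq0_normc.
exact: Normc.normc0.
Qed.

Lemma Re_le_Nc z : `|Re z| <= Nc z.
Proof. by rewrite -lecR; apply: normc_ge_Re. Qed.

Lemma Im_le_Nc z : `|Im z| <= Nc z.
Proof. by case: z => a b /=; rewrite -sqrtr_sqr ler_wsqrtr // lerDr sqr_ge0. Qed.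

Lemma Nc_le z : Nc z <= `|Re z| + `|Im z|.
Proof.
case: z => a b /=; rewrite -(ger0_norm (addr_ge0 (normr_ge0 a) (normr_ge0 b))).
rewrite -sqrtr_sqr ler_wsqrtr // sqrrD !real_normK ?num_real // -addrA lerD2l lerDr.
by rewrite mulrn_wge0 // mulr_ge0.
Qed.

Lemma Nc_sub_le z w : Nc z - Nc w <= Nc (z - w).
Proof. by rewrite lerBlDr -{1}(subrK w z); apply: le_normcD. Qed.

Lemma NcX z n : Nc (z ^+ n) = Nc z ^+ n.
Proof.
elim: n => [|n IH]; first by rewrite !expr0 Normc.normc1.
by rewrite !exprS Normc.normcM IH.
Qed.

(** For x nonzero, an integer k > C / |x| contradicts 2^k > k. *)
Lemma le_geometric_eq0 (x C : R) : (forall k, `|x| <= C * 2^-1 ^+ k) -> x = 0.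
Proof.
move=> xC; apply/eqP; rewrite -normr_eq0; apply/negPn/negP => x0.
have xp : 0 < `|x| by rewrite lt_neqAle eq_sym x0 normr_ge0.
have C0 : 0 < C by have := xC 0%N; rewrite expr0 mulr1; apply: lt_le_trans.
pose k := Num.bound (C / `|x|).
have kb : C / `|x| < k%:R by apply: archi_boundP; rewrite divr_ge0 // ltW.
have := xC k; rewrite exprVn ler_pdivlMr ?exprn_gt0 // leNgt => /negP; apply.
rewrite ltr_pdivrMr // mulrC in kb.
apply: (lt_le_trans kb); rewrite ler_pM2l // -natrX ler_nat ltnW //.
exact: ltn_expl.
Qed.
End NormC.

(** * Linearity, bounds and powers of a single pole *)

Section ContourIntegral.
Local Open Scope classical_set_scope.
Local Open Scope ring_scope.
Variable R : realType.
Local Notation Re := (@complex.Re R).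
Local Notation Im := (@complex.Im R).
Local Notation Nc := (@Normc.normc R).
Local Notation mu := (@lebesgue_measure R).
Variable gam : R -> R[i].
Hypothesis pw : piecewise_C1 gam.
Implicit Types f F : R[i] -> R[i].
Local Notation I := (contour_integral gam).
Local Notation on := (on_contour gam).
Local Notation cc := (contour_continuous gam).

Lemma eq_contour_integral f F : (forall z, on z -> f z = F z) -> I f = I F.
Proof.
move=> fF; have integrandE t : t \in `[0, 1]%classic ->
    cintegrand gam f t = cintegrand gam F t.
  by rewrite inE /= in_itv /= => t01; rewrite /cintegrand fF //; exists t.
by apply: ReIm_eq; apply: eq_Rintegral => t t01; congr complex.Re + congr complex.Im;
  apply: integrandE.
Qed.

Lemma contour_integralD f F : cc f -> cc F -> I (fun z => f z + F z) = I f + I F.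
Proof.
move=> /(contour_integrable pw)[f1 f2] /(contour_integrable pw)[F1 F2].
apply: ReIm_eq; rewrite ?cReD ?cImD -RintegralD //; apply: eq_Rintegral => t _ /=.
  by rewrite mulrDl cReD.
by rewrite mulrDl cImD.
Qed.

Lemma contour_integralZ c f : cc f -> I (fun z => c * f z) = c * I f.
Proof.
move=> /(contour_integrable pw)[f1 f2].
have Z (a b : R) (u v : R -> R) :
    mu.-integrable `[0, 1] (EFin \o u) -> mu.-integrable `[0, 1] (EFin \o v) ->
    (\int[mu]_(t in `[0, 1]) (a * u t + b * v t) =
     a * \int[mu]_(t in `[0, 1]) u t + b * \int[mu]_(t in `[0, 1]) v t)%R.
  move=> iu iv; rewrite RintegralD //; last 2 first.
  - by apply: (integrableZl _ a iu).
  - by apply: (integrableZl _ b iv).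
  by rewrite !RintegralZl.
apply: ReIm_eq.
  rewrite cReM -mulNr -Z //; apply: eq_Rintegral => t _ /=.
  by rewrite -mulrA cReM mulNr.
rewrite cImM -Z //; apply: eq_Rintegral => t _ /=.
by rewrite -mulrA cImM.
Qed.

Lemma contour_integral_sum (J : Type) (s : seq J) (P : pred J) (f : J -> R[i] -> R[i]) :
  (forall j, P j -> cc (f j)) ->
  I (fun z => \sum_(j <- s | P j) f j z) = \sum_(j <- s | P j) I (f j).
Proof.
move=> cf.
have cs s' : cc (fun z => \sum_(j <- s' | P j) f j z).
  elim: s' => [|j s' IH] g t gC1 gt.
    by apply: (eq_ccont _ (ccont_cst 0 t)) => u; rewrite big_nil.
  case Pj: (P j); last by apply: (eq_ccont _ (IH g t gC1 gt)) => u; rewrite big_cons Pj.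
  apply: (eq_ccont _ (ccontD (cf j Pj g t gC1 gt) (IH g t gC1 gt))) => u.
  by rewrite big_cons Pj.
elim: s => [|j s IH].
  rewrite big_nil -[RHS](mul0r (I (fun=> 1))).
  rewrite -contour_integralZ; last exact: contour_continuous_cst.
  by apply: eq_contour_integral => z _; rewrite big_nil mul0r.
rewrite big_cons; case Pj: (P j); last first.
  by rewrite -IH; apply: eq_contour_integral => z _; rewrite big_cons Pj.
rewrite -IH -contour_integralD //; last exact: cf.
by apply: eq_contour_integral => z _; rewrite big_cons Pj.
Qed.

(** An upper bound for the length of the contour: the integrand for the constant 1 is the velocity,
    whose modulus is at most |Re| + |Im|. *)
Definition arc_bound : R :=
  (\int[mu]_(t in `[0, 1]) (`|Re (cintegrand gam (fun=> 1%R) t)| +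
    `|Im (cintegrand gam (fun=> 1%R) t)|))%R.

Lemma arc_bound_ge0 : 0 <= arc_bound.
Proof. by apply: Rintegral_ge0 => t _; rewrite addr_ge0. Qed.

Lemma contour_integral_le f M : cc f -> (forall z, on z -> Nc (f z) <= M) ->
  `|Re (I f)| <= arc_bound * M /\ `|Im (I f)| <= arc_bound * M.
Proof.
move=> /(contour_integrable pw)[f1 f2] fM.
have [g1 g2] := contour_integrable pw (@contour_continuous_cst _ gam 1).
have ig : mu.-integrable `[0, 1]
   (EFin \o (fun t => `|Re (cintegrand gam (fun=> 1%R) t)| +
     `|Im (cintegrand gam (fun=> 1%R) t)|)).
  by apply: (integrableD _ (integrable_norm g1) (integrable_norm g2)).
have key t : t \in `[0, 1]%R -> `|Re (cintegrand gam f t)| <=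
     (`|Re (cintegrand gam (fun=> 1) t)| + `|Im (cintegrand gam (fun=> 1) t)|) * M /\
     `|Im (cintegrand gam f t)| <=
     (`|Re (cintegrand gam (fun=> 1) t)| + `|Im (cintegrand gam (fun=> 1) t)|) * M.
  move=> t01; have fMt : Nc (f (gam t)) <= M by apply: fM; exists t.
  have H : Nc (cintegrand gam f t) <=
     (`|Re (cintegrand gam (fun=> 1) t)| + `|Im (cintegrand gam (fun=> 1) t)|) * M.
    rewrite /cintegrand !mul1r Normc.normcM mulrC ler_pM ?Nc_ge0 //; exact: Nc_le.
  by split; apply: le_trans H; [exact: Re_le_Nc|exact: Im_le_Nc].
split; apply: le_trans (le_normr_Rintegral _ _) _ => //.
  rewrite -RintegralZr //; apply: le_Rintegral => //.
  - exact: integrable_norm.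
  - by apply: (integrableZr _ M ig).
  - by move=> t t01; have [] := key t t01.
rewrite -RintegralZr //; apply: le_Rintegral => //.
- exact: integrable_norm.
- by apply: (integrableZr _ M ig).
- by move=> t t01; have [] := key t t01.
Qed.

(** Continuity is known only along C1 curves, so the extreme value theorem is applied to the real
    and imaginary parts on each piece and the bounds are combined. *)
Lemma contour_bounded f : cc f -> exists2 M, 0 < M & forall z, on z -> Nc (f z) <= M.
Proof.
move=> cf; have [m [t [t0 tm tS pieces]]] := contour_pieces pw.
have seg (h : R -> R) a b : a < b -> (forall u, a <= u <= b -> {for u, continuous h}) ->
    exists M, forall u, a <= u <= b -> `|h u| <= M.
  move=> ab ch.
  have [|c _ cM] := @EVT_max R (fun u => `|h u|) a b (ltW ab).
    apply: continuous_in_subspaceT => u; rewrite inE /= in_itv /= => /ch; exact: cvg_norm.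
  by exists `|h c| => u uab; apply: cM; rewrite in_itv.
suff : exists2 M, 0 < M & forall u, t 0%N <= u <= t m -> Nc (f (gam u)) <= M.
  case=> M M0 fM; exists M => // z [u u01 <-].
  by apply: fM; rewrite t0 tm.
elim: m {tm} tS pieces => [|k IH] tS pieces.
  exists (Nc (f (gam (t 0%N))) + 1); first by rewrite ltr_wpDl // Nc_ge0.
  by move=> u; rewrite -eq_le => /eqP <-; rewrite lerDl.
have [M1 M10 fM1] := IH (fun k km => tS k (ltnW km)) (fun k km => pieces k (ltnW km)).
have [g gC1 [gE gon]] := pieces k (leqnn _).
have cfg u : t k <= u <= t k.+1 -> ccont (fun u => f (g u)) u.
  by move=> uk; apply: cf => //; apply: gon.
have [M2 fM2] := seg (fun u => Re (f (g u))) _ _ (tS k (leqnn _)) (fun u uk => (cfg u uk).1).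
have [M3 fM3] := seg (fun u => Im (f (g u))) _ _ (tS k (leqnn _)) (fun u uk => (cfg u uk).2).
exists (Num.max M1 (M2 + M3)); first by rewrite lt_max M10.
move=> u /andP[u0 uk]; have [utk|tku] := leP u (t k).
  by rewrite le_max fM1 // u0 utk.
have uk' : t k <= u <= t k.+1 by rewrite (ltW tku) uk.
rewrite le_max orbC gE //; apply/orP; left; apply: le_trans (Nc_le _) _.
by rewrite lerD ?fM2 ?fM3.
Qed.

Lemma contour_continuous_pole p : ~ on p -> cc (fun z => (z - p)^-1).
Proof.
move=> np; apply: contour_continuousV.
  by move=> z oz; rewrite subr_eq0; apply/eqP => zp; apply: np; rewrite -zp.
apply: contour_continuousD; [exact: contour_continuous_id|exact: contour_continuous_cst].
Qed.

Lemma cderX (h : R -> R[i]) t d n : cder h t d ->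
  cder (fun u => h u ^+ n.+1) t (n.+1%:R * h t ^+ n * d).
Proof.
move=> dh; elim: n => [|n IH].
  by apply: (cder_eq _ _ dh) => [u|]; rewrite ?expr1 // expr0 !mul1r.
apply: (cder_eq _ _ (cderM dh IH)) => [u|]; first by rewrite [RHS]exprS.
rewrite -[n.+2]addn1 natrD [h t ^+ n.+1]exprS; ring.
Qed.

Hypothesis closed_gam : gam 0 = gam 1.

Lemma contour_integral_pole_pow p n : ~ on p -> I (fun z => (z - p)^-1 ^+ n.+2) = 0.
Proof.
move=> np; rewrite (@contour_FTC _ _ pw _ (fun z => - n.+1%:R^-1 * (z - p)^-1 ^+ n.+1)).
- by rewrite closed_gam subrr.
- exact/contour_continuousX/contour_continuous_pole.
move=> g t gC1 gt.
have dg : cder (fun u => g u - p) t (cderive g t).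
  by apply: (cder_eq _ _ (cderD (is_C1_cder t gC1) (cder_cst (- p) t))) => //; rewrite addr0.
have gp0 : g t - p != 0.
  by rewrite subr_eq0; apply/eqP => gp; apply: np; rewrite -gp.
have := cderM (cder_cst (- n.+1%:R^-1) t) (cderX n (cderV gp0 dg)).
apply: cder_eq => //; rewrite mulr0 addr0.
have n0 : n.+1%:R != 0 :> R[i] by rewrite pnatr_eq0.
rewrite -exprVn; move: ((g t - p)^-1) => w; rewrite !exprS.
move: (n.+1%:R : R[i]) n0 => c c0; field.
by rewrite c0.
Qed.
End ContourIntegral.

(** * Winding numbers and products of poles *)

Section Winding.
Local Open Scope classical_set_scope.
Local Open Scope ring_scope.
Variable R : realType.
Local Notation Re := (@complex.Re R).
Local Notation Im := (@complex.Im R).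
Local Notation Nc := (@Normc.normc R).
Variable gam : R -> R[i].
Hypothesis pw : piecewise_C1 gam.
Hypothesis closed_gam : gam 0 = gam 1.
Implicit Types (f F : R[i] -> R[i]) (p q z : R[i]).
Local Notation I := (contour_integral gam).
Local Notation on := (on_contour gam).
Local Notation cc := (contour_continuous gam).

Definition pole_integral p := I (fun z => (z - p)^-1).

(* In 1/(z - q) = sum_(k < n) (q-p)^k/(z-p)^(k+1) + ((q-p)/(z-p))^n/(z-q) the terms
   with k > 0 have a primitive, and the integral of the remainder is O(2^-n) when
   q is close to p. *)
Lemma pole_integral_locally_constant p : ~ on p ->
  exists2 d : R, 0 < d &
    forall q, Nc (q - p) < d -> ~ on q /\ pole_integral q = pole_integral p.
Proof.
move=> np; have [M M0 bM] := contour_bounded pw (contour_continuous_pole np).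
have zp0 z : on z -> 0 < Nc (z - p).
  by move=> oz; rewrite Nc_gt0 subr_eq0; apply/eqP => zp; apply: np; rewrite -zp.
have zpM z : on z -> M^-1 <= Nc (z - p).
  by move=> oz; rewrite -[leRHS]invrK lef_pV2 ?posrE ?invr_gt0 ?zp0 // -Normc.normcV bM.
(* 1/M bounds the distance from p to the contour from below. Half of it keeps q off the contour and
   the ratio (q - p)/(z - p) at most 1/2. *)
exists (M^-1 / 2); first by rewrite divr_gt0 ?invr_gt0.
move=> q qp.
have zqM z : on z -> M^-1 / 2 <= Nc (z - q).
  move=> oz; have := Nc_sub_le (z - p) (q - p); have := zpM z oz.
  rewrite opprB addrA subrK => h1 h2; lra.
have nq : ~ on q.
  move=> /zqM; rewrite subrr Normc.normc0 leNgt => /negP; apply.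
  by rewrite divr_gt0 ?invr_gt0.
split=> //.
pose rem k := I (fun z => ((q - p) * (z - p)^-1) ^+ k * (z - q)^-1).
have ccp := contour_continuous_pole np; have ccq := contour_continuous_pole nq.
have cc1 : cc (fun z => (q - p) * (z - p)^-1).
  by apply: contour_continuousM => //; exact: contour_continuous_cst.
have ccr k : cc (fun z => ((q - p) * (z - p)^-1) ^+ k * (z - q)^-1).
  by apply: contour_continuousM => //; apply: contour_continuousX.
have remS k : rem k = rem k.+1 + (q - p) ^+ k * I (fun z => (z - p)^-1 ^+ k.+1).
  rewrite -contour_integralZ //; last exact: contour_continuousX.
  rewrite -contour_integralD //; last first.
    apply: contour_continuousM; [exact: contour_continuous_cst|exact: contour_continuousX].
  apply: eq_contour_integral => z oz.
  have zp1 : z - p != 0 by rewrite -Nc_gt0 zp0.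
  have zq1 : z - q != 0.
    by rewrite -Nc_gt0; apply: lt_le_trans (zqM z oz); rewrite divr_gt0 ?invr_gt0.
  rewrite !exprMn !exprS exprVn; move: (_ ^+ k) (_ ^+ k)^-1 => a b.
  by field; rewrite zp1.
have rem0 : pole_integral q = rem 0%N.
  by apply: eq_contour_integral => z _; rewrite expr0 mul1r.
have rem1 k : rem k.+1 = rem 1%N.
  elim: k => // k <-; rewrite [RHS]remS contour_integral_pole_pow //.
  by rewrite mulr0 addr0.
have remE : rem 1%N = pole_integral q - pole_integral p.
  rewrite rem0 [rem 0%N]remS expr0 mul1r.
  rewrite (eq_contour_integral (F := fun z => (z - p)^-1)); last by move=> z _; rewrite expr1.
  by rewrite addrK.
have bnd k z : on z -> Nc (((q - p) * (z - p)^-1) ^+ k * (z - q)^-1) <= 2 * M * 2^-1 ^+ k.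
  move=> oz; rewrite Normc.normcM NcX mulrC ler_pM ?exprn_ge0 ?Nc_ge0 //.
    rewrite Normc.normcV -[2 * M]invrK lef_pV2 ?posrE.
    - by rewrite invfM mulrC zqM.
    - by apply: lt_le_trans (zqM z oz); rewrite divr_gt0 ?invr_gt0.
    - by rewrite invr_gt0 mulr_gt0.
  rewrite lerXn2r ?nnegrE ?Nc_ge0 ?invr_ge0 // Normc.normcM.
  have -> : 2^-1 = (M^-1 / 2) * M :> R by field; rewrite gt_eqF.
  by rewrite ler_pM ?Nc_ge0 ?bM // ltW.
have small k := contour_integral_le pw (ccr k.+1) (bnd k.+1).
have est k : arc_bound gam * (2 * M * 2^-1 ^+ k.+1) = arc_bound gam * M * 2^-1 ^+ k.
  by rewrite exprS; field.
apply/eqP; rewrite -subr_eq0 -remE; apply/eqP; apply: ReIm_eq.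
  apply: (@le_geometric_eq0 _ _ (arc_bound gam * M)) => k.
  by rewrite -est -(rem1 k); have [] := small k.
apply: (@le_geometric_eq0 _ _ (arc_bound gam * M)) => k.
by rewrite -est -(rem1 k); have [] := small k.
Qed.

Lemma pole_integral_far (e : R) : 0 < e -> exists B : R,
  forall q, B < Nc q -> `|Re (pole_integral q)| <= e /\ `|Im (pole_integral q)| <= e.
Proof.
move=> e0; have [M M0 bM] := contour_bounded pw (@contour_continuous_id _ gam).
have W0 := arc_bound_ge0 gam; pose W := arc_bound gam + 1.
have Wp : 0 < W by rewrite ltr_wpDl.
(* [M] bounds |z| on the contour, so |z - q| is at least W / e there and the integral is at most
   [arc_bound] times e / W. The 1 added in [W] keeps it positive. *)
exists (M + W / e) => q qB.
have far z : on z -> W / e <= Nc (z - q).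
  move=> oz; rewrite -normcN opprB; have := Nc_sub_le q z; have := bM z oz.
  by move=> h1 h2; move: qB h1 h2; set a := W / e; move: (Nc q) (Nc z) (Nc (q - z)) => *; lra.
have We : 0 < W / e by rewrite divr_gt0.
have nq : ~ on q.
  by move=> /far; rewrite subrr Normc.normc0 leNgt We.
have bnd z : on z -> Nc ((z - q)^-1) <= e / W.
  move=> oz; rewrite Normc.normcV -[e / W]invf_div lef_pV2 ?posrE ?far //.
  exact: lt_le_trans (far z oz).
have [h1 h2] := contour_integral_le pw (contour_continuous_pole nq) bnd.
have le_e : arc_bound gam * (e / W) <= e.
  by rewrite mulrCA ler_piMr ?(ltW e0) // ler_pdivrMr // mul1r lerDl.
by split; apply: le_trans le_e.
Qed.

Lemma off_contour p : ~ contour_image gam p -> ~ on p.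
Proof. by move=> np /contour_imageE. Qed.

(** Being locally constant, the integral is constant on the connected component of p off the
    contour. That component contains points of arbitrarily large modulus, where the integral is
    arbitrarily small. *)
Lemma pole_integral_outside p : outside gam p -> pole_integral p = 0.
Proof.
move=> [np unb].
pose C := connected_component (~` contour_image gam) (p : R[i]^o).
have Cp : C p by apply: connected_component_refl.
have open_loc (P : R[i] -> Prop) : (forall q q', ~ on q -> P q ->
    pole_integral q' = pole_integral q -> P q') ->
    open ([set q | ~ on q /\ P q] : set R[i]^o).
  move=> PP; rewrite openE => q [nq Pq].
  have [d d0 dP] := pole_integral_locally_constant nq.
  apply/nbhs_ballP; exists d%:C%C; first by rewrite /= ltcR.
  move=> q'; rewrite -ball_normE /= => qq'.
  have /dP[nq' e'] : Nc (q' - q) < d by rewrite -ltcR -normcN opprB.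
  by split=> //; apply: PP e'.
have CE : C `&` [set q | pole_integral q = pole_integral p] = C.
  apply: (@component_connected _ (~` contour_image gam) (p : R[i]^o)).
  - by exists p.
  - exists ([set q | ~ on q /\ pole_integral q = pole_integral p] : set R[i]^o).
      by apply: open_loc => q q' _ qp ->.
    apply/seteqP; split=> q [Cq]; last by case.
    move=> qp; split=> //; split=> //; apply: off_contour.
    exact: connected_component_sub Cq.
  (* The level set is also relatively closed: the set where the integral takes another value is open
     by the same local constancy. *)
  exists (~` [set q | ~ on q /\ pole_integral q <> pole_integral p] : set R[i]^o).
    by apply: open_closedC; apply: open_loc => q q' _ qp ->.
  apply/seteqP; split=> q [Cq] /=; first by move=> qp; split=> // -[].
  move=> /not_andP[/contrapT oq|/contrapT //].
  by exfalso; move: oq; apply: off_contour; exact: connected_component_sub Cq.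
have large B : exists2 q, C q & B < Nc q.
  apply/not_exists2P => bd; apply: unb.
  exists (`|B|%:C)%C; split; first by rewrite realE lecR normr_ge0.
  move=> x Bx q Cq /=.
  have [//|/negP] := bd q; rewrite -leNgt => qB.
  apply: le_trans (ltW Bx); rewrite -/(C q) in Cq.
  have -> : `|q| = (Nc q)%:C%C by [].
  by rewrite lecR (le_trans qB) ?ler_norm.
have small e : 0 < e -> `|Re (pole_integral p)| <= e /\ `|Im (pole_integral p)| <= e.
  move=> /pole_integral_far[B bB]; have [q Cq qB] := large B.
  have qE : pole_integral q = pole_integral p by move: Cq; rewrite -CE => -[].
  by have := bB q qB; rewrite qE.
have eq0 (x : R) : (forall e, 0 < e -> `|x| <= e) -> x = 0.
  move=> xe; apply/eqP; rewrite -normr_le0; apply/ler_addgt0Pl => e /xe.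
  by rewrite addr0.
by apply: ReIm_eq; apply: eq0 => e /small[].
Qed.

(* Induction on the number of poles: two distinct poles are separated by partial
   fractions, a single multiple pole has a primitive. *)
Lemma contour_integral_prod_poles (w : R[i]) (s : seq R[i]) : (1 < size s)%N ->
  (forall p, p \in s -> ~ on p /\ pole_integral p = w) ->
  I (fun z => \prod_(p <- s) (z - p)^-1) = 0.
Proof.
elim: (size s) {-2}s (leqnn (size s)) => [|n IH] {}s; first by rewrite leqn0 => /eqP ->.
move=> sn s1 sw.
have ccs s' : {subset s' <= s} -> cc (fun z => \prod_(p <- s') (z - p)^-1).
  move=> s's; rewrite (_ : (fun z => _) = fun z => \prod_(p <- s' | p \in s') (z - p)^-1).
    apply: contour_continuous_prod => p /s's /sw[np _]; exact: contour_continuous_pole.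
  by apply/funext => z; rewrite big_seq.
case: s sn s1 sw ccs => [//|p s] sn s1 sw ccs.
have [np pE] := sw p (mem_head _ _).
have [/allP all_p|/allPn[q qs qp]] := boolP (all (pred1 p) s).
  have /all_pred1P -> : all (pred1 p) s by apply/allP.
  have : (0 < size s)%N by [].
  case: (size s) => [//|k] _.
  rewrite (eq_contour_integral (F := fun z => (z - p)^-1 ^+ k.+2)).
    exact: contour_integral_pole_pow.
  by move=> z _; rewrite big_cons big_nseq iter_mulr_1 -exprS.
have [nq qE] := sw q (mem_behead (s := p :: s) qs).
have pq : p - q != 0 by rewrite subr_eq0 eq_sym.
have sub1 : {subset p :: rem q s <= p :: s}.
  by move=> x; rewrite !inE => /orP[->//|/mem_rem ->]; rewrite orbT.
have sub2 : {subset s <= p :: s} by move=> x xs; rewrite inE xs orbT.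
have size_rem_q : size (p :: rem q s) = size s.
  by rewrite /= size_rem // prednK //; case: (s) qs.
have E z : on z -> \prod_(x <- p :: s) (z - x)^-1 =
   (p - q)^-1 * (\prod_(x <- p :: rem q s) (z - x)^-1) +
   - (p - q)^-1 * \prod_(x <- s) (z - x)^-1.
  move=> oz.
  have zp : z - p != 0 by rewrite subr_eq0; apply/eqP => e; apply: np; rewrite -e.
  have zq : z - q != 0 by rewrite subr_eq0; apply/eqP => e; apply: nq; rewrite -e.
  rewrite !big_cons (perm_big _ (perm_to_rem qs)) /= big_cons.
  move: (\prod_(x <- rem q s) _) => P; field.
  by rewrite zp zq pq.
rewrite (eq_contour_integral E) contour_integralD //; last 2 first.
- by apply: contour_continuousM; [exact: contour_continuous_cst|exact: ccs].
- by apply: contour_continuousM; [exact: contour_continuous_cst|exact: ccs].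
rewrite !contour_integralZ //; [|exact: ccs..].
have [s_gt1|] := ltnP 1 (size s).
  rewrite (IH (p :: rem q s)) ?size_rem_q //; last by move=> x /sub1; exact: sw.
  rewrite (IH s) //; last by move=> x /sub2; exact: sw.
  by rewrite !mulr0 addr0.
(* With exactly two poles, the two remaining integrals have a single pole each and the common value
   [w], with opposite coefficients. *)
case: s qs s1 {sn sw ccs E sub1 sub2 size_rem_q} => [//|x [|//]].
rewrite inE => /eqP <- _ _; rewrite /= eqxx.
have single a : I (fun z => \prod_(x <- [:: a]) (z - x)^-1) = pole_integral a.
  by apply: eq_contour_integral => z _; rewrite big_seq1.
by rewrite !single pE qE mulNr subrr.
Qed.
End Winding.

(** * Biorthogonality *)

Section PartDet.
Local Open Scope classical_set_scope.
Local Open Scope ring_scope.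
Variables (K : comNzRingType) (N : nat) (lam mu : N.-tuple nat).
Hypotheses (hlam : signature lam) (hmu : signature mu).

Lemma part_pos_inj : injective (part_pos lam).
Proof.
move=> i j e; apply: val_inj; case: (ltngtP i j) => // ij.
  by have := part_pos_lt hlam ij; rewrite e ltnn.
by have := part_pos_lt hlam ij; rewrite e ltnn.
Qed.

(** Both lists of positions have N distinct elements, so inclusion is equality, and monotone lists
    with the same elements coincide. *)
Lemma part_pos_sub : (forall i, exists j, part_pos lam i = part_pos mu j) -> lam = mu.
Proof.
move=> sub.
pose a := [seq part_pos lam j | j : 'I_N]; pose b := [seq part_pos mu j | j : 'I_N].
have ua : uniq a by rewrite map_inj_uniq ?enum_uniq //; exact: part_pos_inj.
have ab : {subset a <= b}.
  by move=> k /mapP[i _ ->]; have [j ->] := sub i; apply: map_f; rewrite mem_enum.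
have [|_ abE] := uniq_min_size ua ab; first by rewrite !size_map.
have revE : rev a = rev b.
  apply: (irr_sorted_eq ltn_trans ltnn); [exact: sorted_part_pos|exact: sorted_part_pos|].
  by move=> k; rewrite !mem_rev abE.
have {}abE : a = b by rewrite -[a]revK revE revK.
apply: eq_from_tnth => i.
have /eqP : part_pos lam i = part_pos mu i by move/eq_in_map: abE => -> //; rewrite mem_enum.
by rewrite /part_pos eqn_add2r => /eqP.
Qed.

(** For equal signatures the matrix is the identity; otherwise some position of [lam] is missing
    from [mu] and gives a zero row. *)
Lemma det_part_delta :
  \det (\matrix_(i < N, j < N) (part_pos lam i == part_pos mu j)%:R) =
  (lam == mu)%:R :> K.
Proof.
have [<-|ne] := eqVneq lam mu.
  rewrite -[RHS](det1 K N); congr (\det _); apply/matrixP => i j.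
  by rewrite !mxE (inj_eq part_pos_inj).
have /existsP[i /forallP hi] : [exists i, [forall j, part_pos lam i != part_pos mu j]].
  apply: contraNT ne; rewrite negb_exists => /forallP h; apply/eqP/part_pos_sub => i.
  have := h i; rewrite negb_forall => /existsP[j]; rewrite negbK => /eqP e.
  by exists j.
rewrite (expand_det_row _ i) big1 // => j _.
by rewrite mxE (negbTE (hi j)) mul0r.
Qed.
End PartDet.

(** * Iterated integrals of sums of products *)

Section Iterated.
Local Open Scope classical_set_scope.
Local Open Scope ring_scope.
Variable R : realType.
Variable gam : R -> R[i].
Hypothesis pw : piecewise_C1 gam.
Local Notation I := (contour_integral gam).
Local Notation on := (on_contour gam).
Local Notation cc := (contour_continuous gam).

(** No Fubini argument is involved: the factor in the outermost variable is constant for the inner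
    integrals and joins the coefficient [c j]. *)
Lemma iterated_contour_integral_sum (J : Type) (js : seq J) N (c : J -> R[i])
    (G : J -> 'I_N -> R[i] -> R[i]) (f : N.-tuple R[i] -> R[i]) :
  (forall j i, cc (G j i)) ->
  (forall z : N.-tuple R[i], (forall i, on (tnth z i)) ->
     f z = \sum_(j <- js) c j * \prod_(i < N) G j i (tnth z i)) ->
  iterated_contour_integral gam f =
  \sum_(j <- js) c j * \prod_(i < N) I (G j i).
Proof.
elim: N c G f => [|N IH] c G f ccG fE /=.
  by rewrite fE; [apply: eq_bigr => j _; rewrite !big_ord0|case].
rewrite (@eq_contour_integral _ _ _ (fun z => \sum_(j <- js)
   (c j * \prod_(i < N) I (G j (lift ord0 i))) * G j ord0 z)); last first.
  move=> z oz.
  rewrite (IH (fun j => c j * G j ord0 z) (fun j i => G j (lift ord0 i))) //.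
    by apply: eq_bigr => j _; rewrite mulrAC.
  move=> w ow; rewrite fE; last first.
    by move=> i; case: (unliftP ord0 i) => [k|] ->; rewrite ?tnthS ?tnth0.
  apply: eq_bigr => j _; rewrite big_ord_recl tnth0 mulrA; congr (_ * _).
  by apply: eq_bigr => i _; rewrite tnthS.
rewrite contour_integral_sum //; last first.
  by move=> j _; apply: contour_continuousM => //; exact: contour_continuous_cst.
apply: eq_bigr => j _; rewrite contour_integralZ // big_ord_recl.
by rewrite -mulrA [X in _ * X]mulrC.
Qed.
End Iterated.

Section Biorthogonality.
Local Open Scope classical_set_scope.
Local Open Scope ring_scope.
Variable R : realType.
Variable gam : R -> R[i].
Hypotheses (pw : piecewise_C1 gam) (closed_gam : gam 0 = gam 1).
Variables (y s : nat -> R[i]).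
Hypothesis hs : forall k, s k != 0.
Hypothesis hccw : counterclockwise gam.
Hypothesis hin : forall k, inside gam (y k).
Hypothesis hout : forall k, outside gam (y k * s k ^- 2).
Local Notation I := (contour_integral gam).
Local Notation on := (on_contour gam).
Local Notation cc := (contour_continuous gam).
Let w k := y k * s k ^- 2.

Lemma off_y k : ~ on (y k).
Proof. by apply: off_contour; have [] := hin k. Qed.

Lemma off_w k : ~ on (w k).
Proof. by apply: off_contour; have [] := hout k. Qed.

Lemma sub_y_neq0 k z : on z -> y k - z != 0.
Proof. by move=> oz; rewrite subr_eq0; apply/eqP => e; apply: (@off_y k); rewrite e. Qed.

Lemma sub_w_neq0 k z : on z -> w k - z != 0.
Proof. by move=> oz; rewrite subr_eq0; apply/eqP => e; apply: (@off_w k); rewrite e. Qed.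

Lemma sub_s_w k z : y k - s k ^+ 2 * z = s k ^+ 2 * (w k - z).
Proof. by rewrite /w; field; rewrite hs. Qed.

(** Written with the points w_j, the product in psi is the inverse of the product in phi, whence the
    cancellations in phi_k psi_l. *)
Lemma psiE k z : on z ->
  psi k z y s = (y k - w k) / (w k - z) * \prod_(0 <= j < k) ((y j - z) / (w j - z)).
Proof.
move=> oz; rewrite /psi sub_s_w big_mkord; congr (_ * _).
  have e : y k = s k ^+ 2 * w k by rewrite /w; field; rewrite hs.
  have wz := sub_w_neq0 k oz; rewrite {1 2}e; move: (w k) wz => v wz; field.
  by rewrite hs wz.
apply: eq_bigr => j _; rewrite sub_s_w; field.
by rewrite hs sub_w_neq0.
Qed.

Lemma phiE k z :
  phi k z y s = (y k - z)^-1 * \prod_(0 <= j < k) ((w j - z) / (y j - z)).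
Proof.
rewrite /phi big_mkord; congr (_ * _); apply: eq_bigr => j _.
by rewrite /w [y j * _]mulrC.
Qed.

Lemma contour_continuous_sub_inv p : ~ on p -> cc (fun z => (p - z)^-1).
Proof.
move=> np; apply: contour_continuousV.
  by move=> z oz; rewrite subr_eq0; apply/eqP => e; apply: np; rewrite e.
apply: contour_continuousD; first exact: contour_continuous_cst.
by apply: contour_continuousN; exact: contour_continuous_id.
Qed.

Lemma contour_continuous_sub p : cc (fun z => p - z).
Proof.
apply: contour_continuousD; first exact: contour_continuous_cst.
by apply: contour_continuousN; exact: contour_continuous_id.
Qed.

Lemma contour_continuous_phi k : cc (fun z => phi k z y s).
Proof.
apply: contour_continuousM; first by apply: contour_continuous_sub_inv; exact: off_y.
apply: contour_continuous_prod => j _; apply: contour_continuousM.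
  exact: contour_continuous_sub.
by apply: contour_continuous_sub_inv; exact: off_y.
Qed.

Lemma contour_continuous_psi k : cc (fun z => psi k z y s).
Proof.
have cinv j : cc (fun z => (y j - s j ^+ 2 * z)^-1).
  apply: contour_continuousV.
    by move=> z oz; rewrite sub_s_w mulf_neq0 ?expf_neq0 ?sub_w_neq0.
  apply: contour_continuousD; first exact: contour_continuous_cst.
  apply: contour_continuousN; apply: contour_continuousM; last exact: contour_continuous_id.
  exact: contour_continuous_cst.
apply: contour_continuousM; first apply: contour_continuousM => //.
  exact: contour_continuous_cst.
apply: contour_continuous_prod => j _; apply: contour_continuousM => //.
by apply: contour_continuousM; [exact: contour_continuous_cst|exact: contour_continuous_sub].
Qed.

Lemma contour_continuous_poles_times (c P : nat -> R[i]) (ps : seq R[i]) (J : seq nat) :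
  (forall p, p \in ps -> ~ on p) -> (forall j, ~ on (P j)) ->
  cc (fun z => (\prod_(p <- ps) (z - p)^-1) * \prod_(j <- J) (1 + c j * (z - P j)^-1)).
Proof.
move=> nps nP; apply: contour_continuousM.
  rewrite (_ : (fun z => _) = fun z => \prod_(p <- ps | p \in ps) (z - p)^-1).
    by apply: contour_continuous_prod => p /nps; exact: contour_continuous_pole.
  by apply/funext => z; rewrite big_seq.
apply: contour_continuous_prod => i _; apply: contour_continuousD.
  exact: contour_continuous_cst.
apply: contour_continuousM; first exact: contour_continuous_cst.
exact: contour_continuous_pole.
Qed.

(** Each factor 1 + c/(z - P) either disappears or adds a pole with the same winding number, so at
    least two poles remain throughout the expansion. *)
Lemma contour_integral_poles_times (v : R[i]) (c P : nat -> R[i]) (ps : seq R[i]) (J : seq nat) :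
  (1 < size ps)%N -> (forall p, p \in ps -> ~ on p /\ pole_integral gam p = v) ->
  (forall j, ~ on (P j) /\ pole_integral gam (P j) = v) ->
  I (fun z => (\prod_(p <- ps) (z - p)^-1) * \prod_(j <- J) (1 + c j * (z - P j)^-1)) = 0.
Proof.
move=> + + Pv; elim: J ps => [|j J IH] ps ps1 psv.
  rewrite -[RHS](contour_integral_prod_poles pw closed_gam ps1 psv).
  by apply: eq_contour_integral => z _; rewrite big_nil mulr1.
have ccf ps' : (forall p, p \in ps' -> ~ on p /\ pole_integral gam p = v) ->
    cc (fun z => (\prod_(p <- ps') (z - p)^-1) * \prod_(j <- J) (1 + c j * (z - P j)^-1)).
  move=> psv'; apply: contour_continuous_poles_times; first by move=> p /psv'[].
  by move=> i; have [] := Pv i.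
have psv' p : p \in P j :: ps -> ~ on p /\ pole_integral gam p = v.
  by rewrite inE => /orP[/eqP ->|/psv].
rewrite (@eq_contour_integral _ _ _ (fun z =>
   (\prod_(p <- ps) (z - p)^-1) * \prod_(j <- J) (1 + c j * (z - P j)^-1) +
   c j * ((\prod_(p <- P j :: ps) (z - p)^-1) *
      \prod_(j <- J) (1 + c j * (z - P j)^-1)))); last first.
  by move=> z _; rewrite !big_cons; ring.
rewrite contour_integralD //; last 2 first.
- exact: ccf.
- by apply: contour_continuousM; [exact: contour_continuous_cst|exact: ccf].
rewrite contour_integralZ //; last exact: ccf.
by rewrite !IH ?mulr0 ?addr0 //; exact: ltnW.
Qed.

Lemma pole_y k : ~ on (y k) /\ pole_integral gam (y k) = twoipi R.
Proof. by split; [exact: off_y|apply: hccw]. Qed.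

Lemma pole_w k : ~ on (w k) /\ pole_integral gam (w k) = 0.
Proof. by split; [exact: off_w|exact: (pole_integral_outside pw closed_gam (hout k))]. Qed.

Lemma prod_inv_ratio (I' : Type) (r : seq I') (a b : I' -> R[i]) :
  (forall i, a i != 0) -> (forall i, b i != 0) ->
  (\prod_(i <- r) (a i / b i)) * (\prod_(i <- r) (b i / a i)) = 1.
Proof.
move=> a0 b0; rewrite -big_split big1 //= => i _.
by field; rewrite a0 b0.
Qed.

(* After cancellation phi_k psi_l has poles only among the w_j when k < l, only
   among the y_j when k > l, and it decays at least like z^-2. *)
Lemma phi_psi_integral k l :
  I (fun z => phi k z y s * psi l z y s) = (k == l)%:R * twoipi R.
Proof.
have ratio (a b z : R[i]) : a - z != 0 ->
    (b - z) / (a - z) = 1 + (a - b) * (z - a)^-1.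
  by move=> az; rewrite -[z - a]opprB; field; rewrite ?oppr_eq0 az.
have inv2 (a b c z : R[i]) : a - z != 0 -> b - z != 0 ->
   c / (a - z) * (b - z)^-1 = c * ((z - a)^-1 * (z - b)^-1).
  move=> az bz; rewrite -[z - a]opprB -[z - b]opprB; field.
  by rewrite ?oppr_eq0 az bz.
have pu z : on z -> forall r, (\prod_(j <- r) ((y j - z) / (w j - z))) *
    (\prod_(j <- r) ((w j - z) / (y j - z))) = 1.
  by move=> oz r; apply: prod_inv_ratio => i; [exact: sub_y_neq0|exact: sub_w_neq0].
case: (ltngtP k l) => [kl|lk|<-].
- rewrite mul0r.
  rewrite (@eq_contour_integral _ _ _ (fun z => (y l - w l) *
     ((\prod_(p <- [:: w l; w k]) (z - p)^-1) *
      \prod_(j <- index_iota k.+1 l) (1 + (w j - y j) * (z - w j)^-1)))); last first.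
    move=> z oz; rewrite phiE psiE // (@big_cat_nat _ _ _ k 0%N l) //=; last exact: ltnW.
    (* The factor of index k in psi_l cancels the pole y_k of phi_k and leaves the pole w_k; the
       factors of index below k cancel in pairs. *)
    rewrite [in X in _ * (_ * (_ * X))]big_ltn // !big_cons big_nil mulr1.
    rewrite [in RHS](eq_bigr (fun j => (y j - z) / (w j - z))); last first.
      by move=> j _; rewrite ratio // sub_w_neq0.
    rewrite [RHS]mulrA -inv2 ?sub_w_neq0 //; have := pu z oz (index_iota 0 k).
    have := sub_y_neq0 k oz; have := sub_w_neq0 l oz; have := sub_w_neq0 k oz.
    move: (\prod_(0 <= i < k) _) (\prod_(0 <= i < k) _) (\prod_(_ <= i < l) _) => a b c.
    move=> wk wl yk ab.
    transitivity ((b * a) * ((y l - w l) / (w l - z) / (w k - z) * c)); last by rewrite ab mul1r.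
    by field; rewrite wk wl yk.
  rewrite contour_integralZ //; last first.
    apply: contour_continuous_poles_times; last exact: off_w.
    by move=> p; rewrite !inE => /orP[] /eqP ->; exact: off_w.
  rewrite (@contour_integral_poles_times 0) ?mulr0 //.
    by move=> p; rewrite !inE => /orP[] /eqP ->; exact: pole_w.
  exact: pole_w.
- rewrite mul0r.
  rewrite (@eq_contour_integral _ _ _ (fun z => (y l - w l) *
     ((\prod_(p <- [:: y k; y l]) (z - p)^-1) *
      \prod_(j <- index_iota l.+1 k) (1 + (y j - w j) * (z - y j)^-1)))); last first.
    move=> z oz; rewrite phiE psiE // (@big_cat_nat _ _ _ l 0%N k) //=; last exact: ltnW.
    rewrite [in X in _ * (_ * X) * _]big_ltn // !big_cons big_nil mulr1.
    rewrite [in RHS](eq_bigr (fun j => (w j - z) / (y j - z))); last first.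
      by move=> j _; rewrite ratio // sub_y_neq0.
    rewrite [RHS]mulrA -inv2 ?sub_y_neq0 //; have := pu z oz (index_iota 0 l).
    have := sub_y_neq0 k oz; have := sub_w_neq0 l oz; have := sub_y_neq0 l oz.
    move: (\prod_(0 <= i < l) _) (\prod_(0 <= i < l) _) (\prod_(_ <= i < k) _) => a b c.
    move=> yl wl yk ab.
    transitivity ((b * a) * ((y l - w l) / (y k - z) / (y l - z) * c)); last by rewrite ab mul1r.
    by field; rewrite wl yl yk.
  rewrite contour_integralZ //; last first.
    apply: contour_continuous_poles_times; last exact: off_y.
    by move=> p; rewrite !inE => /orP[] /eqP ->; exact: off_y.
  rewrite (@contour_integral_poles_times (twoipi R)) ?mulr0 //.
    by move=> p; rewrite !inE => /orP[] /eqP ->; exact: pole_y.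
  exact: pole_y.
rewrite mul1r -[RHS]subr0 -(pole_y k).2 -(pole_w k).2 -mulN1r.
rewrite -contour_integralZ; [|exact: pw|by apply: contour_continuous_pole; exact: off_w].
rewrite -contour_integralD; [|exact: pw|..]; last 2 first.
- by apply: contour_continuous_pole; exact: off_y.
- apply: contour_continuousM; first exact: contour_continuous_cst.
  by apply: contour_continuous_pole; exact: off_w.
apply: eq_contour_integral => z oz; rewrite phiE psiE //.
have := pu z oz (index_iota 0 k).
have := sub_y_neq0 k oz; have := sub_w_neq0 k oz.
move: (\prod_(0 <= i < k) _) (\prod_(0 <= i < k) _) => a b wk yk ab.
transitivity ((b * a) * ((y k - w k) / (w k - z) / (y k - z))); first by field; rewrite wk yk.
rewrite ab mul1r -[z - y k]opprB -[z - w k]opprB; field.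
by rewrite ?oppr_eq0 wk yk.
Qed.
End Biorthogonality.

(** * Evaluation of the iterated integral *)

Section Main.
Local Open Scope classical_set_scope.
Local Open Scope ring_scope.
Variable R : realType.
Variables (N : nat) (lam mu : N.-tuple nat) (y s : nat -> R[i]) (r : 'I_N -> R[i]).
Variable gam : R -> R[i].
Hypotheses (hlam : signature lam) (hmu : signature mu).
Hypothesis hs : forall k, s k != 0.
Hypothesis hgam : simple_closed_contour gam.
Hypothesis hccw : counterclockwise gam.
Hypothesis hin : forall k, inside gam (y k).
Hypothesis hout : forall k, outside gam (y k * s k ^- 2).

Lemma twoipi_neq0 : twoipi R != 0.
Proof.
apply/eqP => /(congr1 (@complex.Im R)) /= /eqP.
by rewrite mulf_eq0 pnatr_eq0 /= gt_eqF ?pi_gt0.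
Qed.

(** For a fixed first permutation, the sum over the second is the determinant with permuted rows,
    and the sign restores the original one. Hence N! equal contributions. *)
Lemma prod_delta_sum (a b : 'I_N -> nat) :
  \sum_(st : {perm 'I_N} * {perm 'I_N}) ((-1) ^+ st.1 * (-1) ^+ st.2) *
     \prod_(i < N) ((a (st.1 i) == b (st.2 i))%:R * twoipi R) =
  N`!%:R * twoipi R ^+ N * \det (\matrix_(i < N, j < N) (a i == b j)%:R).
Proof.
rewrite -(pair_bigA _ (fun s1 s2 : {perm 'I_N} => (-1) ^+ s1 * (-1) ^+ s2 *
   \prod_(i < N) ((a (s1 i) == b (s2 i))%:R * twoipi R))) /=.
set M := \matrix_(i < N, j < N) _.
rewrite (eq_bigr (fun=> twoipi R ^+ N * \det M)); last first.
  move=> s1 _.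
  have -> : \det M = (-1) ^+ s1 * \det (row_perm s1 M).
    by rewrite row_permE det_mulmx det_perm mulrA -expr2 sqrr_sign mul1r.
  rewrite mulrCA !mulr_sumr; apply: eq_bigr => s2 _.
  rewrite big_split /= prodr_const card_ord -!mulrA; congr (_ * _).
  rewrite [RHS]mulrC -!mulrA; congr (_ * _); congr (_ * _).
  by apply: eq_bigr => i _; rewrite !mxE.
rewrite sumr_const -mulrA mulr_natl; congr (_ *+ _); rewrite -[RHS]card_Sn; exact: eq_card.
Qed.

Lemma iterated_integrand :
  iterated_contour_integral gam (fun z : N.-tuple R[i] =>
    ratval (integrand lam mu y s) (zr_point (tnth z) r)) =
  N`!%:R * twoipi R ^+ N * (lam == mu)%:R.
Proof.
have [pw closed_gam _] := hgam.
rewrite -(det_part_delta _ hlam hmu) -prod_delta_sum.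
pose G (st : {perm 'I_N} * {perm 'I_N}) (i : 'I_N) z :=
  phi (part_pos lam (st.1 i)) z y s * psi (part_pos mu (st.2 i)) z y s.
rewrite (@iterated_contour_integral_sum _ _ pw _ (index_enum _) _
  (fun st : {perm 'I_N} * {perm 'I_N} => (-1) ^+ st.1 * (-1) ^+ st.2) G).
- apply: eq_bigr => st _; congr (_ * _); apply: eq_bigr => i _.
  exact: phi_psi_integral.
- move=> st i; apply: contour_continuousM; first exact: contour_continuous_phi.
  exact: contour_continuous_psi.
(* On the contour the z_i avoid all y_k and y_k s_k^-2, so the value of the rational function is the
   product of determinants. *)
move=> z oz; rewrite (ratval_has_value (integrand_value mu hlam r hs _ _)); first last.
- move=> i k; rewrite -subr_eq0 sub_s_w // mulf_neq0 ?expf_neq0 //.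
  exact: (sub_w_neq0 hout).
- by move=> i k; rewrite -subr_eq0; exact: (sub_y_neq0 hin).
rewrite /determinant mulr_suml.
rewrite -(pair_bigA _ (fun s1 s2 : {perm 'I_N} => (-1) ^+ s1 * (-1) ^+ s2 *
   \prod_(i < N) G (s1, s2) i (tnth z i))) /=.
apply: eq_bigr => s1 _; rewrite mulr_sumr; apply: eq_bigr => s2 _.
rewrite mulrACA -big_split /=; congr (_ * _); apply: eq_bigr => i _.
by rewrite !mxE.
Qed.
End Main.

Theorem proposition5p4 (R : realType) (N : nat) (lam mu : N.-tuple nat)
    (y s : nat -> R[i]) (r : 'I_N -> R[i]) (gam : R -> R[i])
    (hN : (0 < N)%N) (hlam : signature lam) (hmu : signature mu)
    (hr : forall i, r i != 0) (hs : forall k, s k != 0)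
    (hgam : simple_closed_contour gam) (hccw : counterclockwise gam)
    (hin : forall k, inside gam (y k))
    (hout : forall k, outside gam (y k * s k ^- 2)) :
  (N`!%:R * twoipi R ^+ N)^-1 *
    iterated_contour_integral gam (fun z : N.-tuple R[i] =>
      ratval (integrand lam mu y s) (zr_point (tnth z) r))
  = (lam == mu)%:R
  /\
  forall (i j : 'I_N) (z : 'I_N -> R[i]),
    z j = r i ^- 2 * z i ->
    (forall a k, z a <> y k /\ z a <> y k * s k ^- 2) ->
    regular_at (integrand lam mu y s) (zr_point z r).
Proof.
split.
  rewrite iterated_integrand // mulrA mulVf ?mul1r //.
  by rewrite mulf_neq0 ?expf_neq0 ?twoipi_neq0 // pnatr_eq0 -lt0n fact_gt0.
(* The denominators in the product of determinants vanish only at the points y_k and y_k s_k^-2, so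
   the product supplies a value at this point, and a value witnesses regularity. *)
move=> _ _ z _ zy; apply: rat_has_value_regular; apply: (integrand_value mu hlam r hs).
  by move=> i k; apply/eqP => e; have [] := zy i k; rewrite e.
move=> i k; apply/eqP => e; have [_] := zy i k; apply.
by rewrite e; field; rewrite hs.
Qed.
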